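(* There exist constants $\gamma>0$ and $\kappa>1$ such that the following holds for every $a\in(0,1)$, every $L\ge 9$ and every $\sigma\in(0,\tfrac12]$ with $\sigma\ge \frac{11}{10}L^{-1/2}$. Let $\Omega=[-\sigma,\sigma]^{\mathbb N}$, let $\mathbb P=\left(\frac{\mathrm{Leb}_{[-\sigma,\sigma]}}{2\sigma}\right)^{\otimes\mathbb N}$ (so that the coordinates $\omega_0,\omega_1,\dots$ are i.i.d. uniformly distributed on $[-\sigma,\sigma]$), let $\theta$ be the left shift on $\Omega$, and let $f^n_\omega=f_{\omega_{n-1}}\circ\dots\circ f_{\omega_0}$, where $f_{\omega_i}:\mathbb S^1\to\mathbb S^1$ is $f_{\omega_i}(x)=L\sin(2\pi(x+\omega_i))+a \pmod 1$. Then: (i) for $\mathbb P\times\mathrm{Leb}$-almost every $(\omega,x)$, $$\liminf_{n\to\infty}\frac1n\log|df^n_\omega(x)|>\gamma\log(L);$$ (ii) there exists a set $\tilde\Omega\subset\Omega$ of full $\mathbb P$-measure such that for every $\omega\in\tilde\Omega$ every pair $(I_0,I_1)$ of disjoint (connected) intervals of $\mathbb S^1$ is an $(\omega,\kappa)$-horseshoe.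
   Context: $\mathbb S^1=\mathbb R/\mathbb Z$, $\mathrm{Leb}$ is Lebesgue measure on $\mathbb S^1$, and $df$ denotes the derivative. An interval is a connected subset of $\mathbb S^1$ with nonempty interior. Definition (horseshoe). Let $I_0,I_1$ be disjoint intervals, $\omega\in\Omega$ and $\kappa>1$. The pair $(I_0,I_1)$ is an $(\omega,\kappa)$-horseshoe if there exist a strictly increasing sequence of nonnegative integers (return times) $\{n_k(\omega)\}_{k\ge0}$ with $\limsup_{k\to\infty} n_k(\omega)/k<\infty$ and a family of subsets $J(k,\omega)_{i,j}$, $k\ge0$, $i,j\in\{0,1\}$, such that for all $k\ge 0$ and $i,j\in\{0,1\}$: $J(k,\omega)_{i,j}\subset I_i$, $$f^{\,n_{k+1}(\omega)-n_k(\omega)}_{\theta^{n_k(\omega)}(\omega)}\big(J(k,\omega)_{i,j}\big)=I_j,$$ and $\big|df^{\,n_{k+1}(\omega)-n_k(\omega)}_{\theta^{n_k(\omega)}(\omega)}(x)\big|>\kappa$ for every $x\in J(k,\omega)_{i,j}$. *)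

(* Defs.v *)
From HB Require Import structures.
From mathcomp Require Import all_boot all_order all_algebra.
From mathcomp Require Import all_classical all_reals all_analysis.

Set Implicit Arguments.
Unset Strict Implicit.
Unset Printing Implicit Defensive.

Import Order.TTheory GRing.Theory Num.Theory.
Import numFieldTopology.Exports numFieldNormedType.Exports.

Local Open Scope classical_set_scope.
Local Open Scope ring_scope.
Local Open Scope quotient_scope.

Section circle.
Context {R : realType}.

Definition eqmodZ (x y : R) : bool := x - y \is a Num.int.

Lemma eqmodZ_refl : reflexive eqmodZ.
Proof. by move=> x; rewrite /eqmodZ subrr rpred0. Qed.

Lemma eqmodZ_sym : symmetric eqmodZ.
Proof. by move=> x y; rewrite /eqmodZ -opprB rpredN. Qed.

Lemma eqmodZ_trans : transitive eqmodZ.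
Proof.
move=> y x z; rewrite /eqmodZ => xy yz.
by rewrite -(subrK y x) -addrA rpredD.
Qed.

Canonical eqmodZ_equiv := EquivRel eqmodZ eqmodZ_refl eqmodZ_sym eqmodZ_trans.

End circle.

(* R/Z, with the quotient topology and its Borel sigma-algebra. *)
Definition circle (R : realType) : Type :=
  quotient_topology {eq_quot (@eqmodZ_equiv R)}.

HB.instance Definition _ (R : realType) := PointedTopological.copy (circle R)
  (quotient_topology {eq_quot (@eqmodZ_equiv R)}).
HB.instance Definition _ (R : realType) := Quotient.copy (circle R)
  (quotient_topology {eq_quot (@eqmodZ_equiv R)}).
HB.instance Definition _ (R : realType) := Measurable.copy (circle R)
  (g_sigma_algebraType (@open (circle R))).

Section circle_calculus.
Context {R : realType}.
Implicit Types (x y t w : R) (u v z : circle R) (g : circle R -> circle R).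

Definition circle_proj x : circle R := \pi_(circle R) x.

(* The representative in [-1/2, 1/2[ of the difference u - v in R/Z. *)
Definition csub u v : R :=
  let t := repr u - repr v in t - (Num.floor (t + 2^-1))%:~R.

Definition circle_translate z t : circle R := circle_proj (repr z + t).

(* The derivative of g at z, read in the local charts t |-> z + t at z and
   v |-> v - g z at g z. *)
Definition cderiv g z : R :=
  derive1 (fun t : R => csub (g (circle_translate z t)) (g z)) 0.

Definition circle_interval (A : set (circle R)) := connected A /\ A^° !=set0.

End circle_calculus.

Section circle_measure.
Context {R : realType}.

Lemma circle_proj_measurable :
  measurable_fun setT (circle_proj : measurableTypeR R -> circle R).
Proof.
apply: (measurability (@open (circle R))) => //.
move=> _ [A oA <-]; rewrite setTI.
by apply: measurable_realfun.open_measurable; exact: oA.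
Qed.

Let unit_itv_measurable : measurable (`[0, 1[ : set (measurableTypeR R)).
Proof. exact: measurable_itv. Qed.

(* Lebesgue measure on R/Z: the image under R -> R/Z of Lebesgue measure on the
   fundamental domain [0, 1[. *)
Definition circle_leb (A : set (circle R)) : \bar R :=
  lebesgue_measure (circle_proj @^-1` A `&` `[0, 1[).

Let circle_lebE :
  circle_leb = pushforward (mrestr lebesgue_measure unit_itv_measurable) circle_proj.
Proof. by []. Qed.

Let circle_leb0 : circle_leb set0 = 0%E.
Proof. by rewrite /circle_leb preimage_set0 set0I measure0. Qed.

Let circle_leb_ge0 A : (0 <= circle_leb A)%E.
Proof. exact: measure_ge0. Qed.

Let circle_leb_sigma_additive : semi_sigma_additive circle_leb.
Proof.
rewrite circle_lebE => F mF tF mUF.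
rewrite /pushforward preimage_bigcup.
apply: measure_semi_sigma_additive.
- by move=> n; rewrite -[X in measurable X]setTI; exact: circle_proj_measurable.
- apply/trivIsetP => /= i j _ _ ij; rewrite -preimage_setI.
  by move/trivIsetP : tF => /(_ _ _ _ _ ij) ->//; rewrite preimage_set0.
- by rewrite -preimage_bigcup -[X in measurable X]setTI; exact: circle_proj_measurable.
Qed.

HB.instance Definition _ := isMeasure.Build _ _ _ circle_leb
  circle_leb0 circle_leb_ge0 circle_leb_sigma_additive.

Let circle_leb_setT : circle_leb setT = 1%E.
Proof.
by rewrite /circle_leb preimage_setT setTI lebesgue_measure_itv/= lte01 oppr0 adde0.
Qed.

HB.instance Definition _ :=
  Measure_isProbability.Build _ _ _ circle_leb circle_leb_setT.

End circle_measure.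

Definition noise (R : realType) (s : {posnum R}) : Type :=
  {x : R | - s%:num <= x <= s%:num}.

HB.instance Definition _ (R : realType) (s : {posnum R}) :=
  [isSub of noise s for @proj1_sig _ _].
HB.instance Definition _ (R : realType) (s : {posnum R}) :=
  [Choice of noise s by <:].

Lemma noise0_subproof (R : realType) (s : {posnum R}) :
  - s%:num <= 0 <= s%:num.
Proof. by rewrite oppr_le0 ge0. Qed.

HB.instance Definition _ (R : realType) (s : {posnum R}) :=
  isPointed.Build (noise s) (exist _ 0 (noise0_subproof s)).

Definition noise_seq (R : realType) (s : {posnum R}) : Type := nat -> noise s.

HB.instance Definition _ (R : realType) (s : {posnum R}) :=
  Pointed.copy (noise_seq s) (nat -> noise s).

Section noise_seq.
Context {R : realType} (s : {posnum R}).

Definition noise_coord (i : nat) (w : noise_seq s) : R := \val (w i).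

Definition noise_coord_preimages : set (set (noise_seq s)) :=
  [set C | exists i, exists2 A : set R,
     measurable A & C = noise_coord i @^-1` A].

Definition noise_leb (A : set R) : \bar R :=
  (((2 * s%:num)^-1)%:E *
   lebesgue_measure (A `&` [set x | - s%:num <= x <= s%:num]%R))%E.

End noise_seq.

(* The product sigma-algebra on [-s, s]^N. *)
HB.instance Definition _ (R : realType) (s : {posnum R}) := Measurable.copy
  (noise_seq s) (g_sigma_algebraType (@noise_coord_preimages R s)).

(* P is the infinite product of the normalized Lebesgue measures on [-s, s];
   being determined by its values on finite-dimensional cylinders, there is only
   one such P. *)
Definition is_product_measure (R : realType) (s : {posnum R})
    (P : probability (noise_seq s) R) :=
  forall (n : nat) (A : nat -> set R), (forall i, measurable (A i)) ->
    P [set w | forall i, (i < n)%N -> A i (noise_coord i w)] =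
    (\prod_(i < n) noise_leb s (A i))%E.

Definition noise_shift (R : realType) (s : {posnum R}) (w : noise_seq s)
  : noise_seq s := fun i => w i.+1.

Section random_maps.
Context {R : realType}.
Implicit Types (L a t : R) (z : circle R).

(* Independent of the choice of the representative of z, as sin (2 pi _) is
   1-periodic. *)
Definition circle_map L a t z : circle R :=
  circle_proj (L * sin (2 * pi * (repr z + t)) + a).

Fixpoint circle_iter (s : {posnum R}) L a (w : noise_seq s) (n : nat) z
  : circle R :=
  if n is m.+1 then circle_map L a (noise_coord m w) (circle_iter L a w m z)
  else z.

Definition is_horseshoe (s : {posnum R}) L a (w : noise_seq s) (kappa : R)
    (I : 'I_2 -> set (circle R)) :=
  exists n : nat -> nat, exists J : nat -> 'I_2 -> 'I_2 -> set (circle R),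
  [/\ forall k, (n k < n k.+1)%N,
      (limn_esup (fun k => ((n k)%:R / k%:R)%:E) < +oo :> \bar R)%E &
      forall (k : nat) (i j : 'I_2),
        let g :=
          circle_iter L a (iter (n k) (@noise_shift R s) w) (n k.+1 - n k) in
        [/\ J k i j `<=` I i,
            g @` J k i j = I j &
            forall x, J k i j x -> kappa < `|cderiv g x| ] ].

End random_maps.

(* Main.v *)
(* The noise prevents orbits from staying close to the zeros of the derivative,
   which are the points [crit k] = 1/4 + k/2.

   (i) The derivative of f^n is the product of the one-step derivatives
   [2 pi L cos (2 pi (x_i + w_i))]. Averaging its [-1/2]-th power over [w_i] gives at most
   [rho = 6 / sqrt (8 pi L sigma)], whatever [x_i] is, and [rho < L^(-1/8)]. By independence
   the mean of [|df^n|^(-1/2)] is at most [rho^n], so by Borel-Cantelli [|df^n|^(-1/2)] is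
   eventually at most [L^(-n/8)].

   (ii) Given two intervals, one can choose a finite word of noises along which two small arcs
   inside them keep away from the critical points, hence grow exponentially, until both wrap
   around the circle. This is an open condition on the word, so it occurs along a cylinder of
   positive probability; and once an interval covers the circle with large derivative, it
   keeps doing so for all later times and all noises. An exponential moment bound shows that
   almost every noise visits the cylinder with positive lower density; the return times are
   the visits, and countably many rational cylinders suffice for all pairs of intervals. *)

Require Import Defs.
From mathcomp Require Import all_boot all_order all_algebra.
From mathcomp Require Import all_classical all_reals all_analysis.
From mathcomp Require Import measurable_realfun ring lra.

Set Implicit Arguments.
Unset Strict Implicit.
Unset Printing Implicit Defensive.

Import Order.TTheory GRing.Theory Num.Theory.
Import numFieldTopology.Exports numFieldNormedType.Exports.

Local Open Scope classical_set_scope.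
Local Open Scope ring_scope.

(** * Lifts to the real line *)

Section circle_lift.
Context {R : realType}.
Implicit Types (x y t : R) (z : circle R).

Lemma circle_projP x y : circle_proj x = circle_proj y <-> x - y \is a Num.int.
Proof.
rewrite /circle_proj; split.
  by move=> /(@eqmodP _ (@eqmodZ_equiv R)).
by move=> h; apply/(@eqmodP _ (@eqmodZ_equiv R)).
Qed.

Lemma circle_reprK z : circle_proj (repr z) = z.
Proof. exact: reprK. Qed.

Lemma repr_circle_proj x : exists k : int, repr (circle_proj x) = x + k%:~R.
Proof.
have /circle_projP/intrP[k hk] := circle_reprK (circle_proj x).
by exists k; rewrite -hk addrC subrK.
Qed.

Lemma continuous_circle_proj : continuous (circle_proj : R -> circle R).
Proof. exact: pi_continuous. Qed.

Lemma sin_int x (k : int) : sin (2 * pi * (x + k%:~R)) = sin (2 * pi * x).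
Proof.
have pn n y : sin (2 * pi * (y + n%:R)) = sin (2 * pi * y).
  by rewrite mulrDr [2 * pi * n%:R]mulr_natr [2 * pi]mulr_natl (periodicn (@sinD2pi R)).
case: k => n; first exact: pn.
by rewrite -[LHS](pn n.+1) NegzE mulrNz subrK.
Qed.

Lemma cos_int x (k : int) : cos (2 * pi * (x + k%:~R)) = cos (2 * pi * x).
Proof.
have pn n y : cos (2 * pi * (y + n%:R)) = cos (2 * pi * y).
  by rewrite mulrDr [2 * pi * n%:R]mulr_natr [2 * pi]mulr_natl (periodicn (@cosD2pi R)).
case: k => n; first exact: pn.
by rewrite -[LHS](pn n.+1) NegzE mulrNz subrK.
Qed.

(** The integers by which [repr] may shift [x] and [y] only change the difference by an integer,
    which the floor in [csub] removes. *)
Lemma csub_proj x y : - 2^-1 <= x - y < 2^-1 ->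
  csub (circle_proj x) (circle_proj y) = x - y.
Proof.
move=> xy; rewrite /csub.
have [k ->] := repr_circle_proj x; have [l ->] := repr_circle_proj y.
have -> : x + k%:~R - (y + l%:~R) = x - y + (k - l)%:~R.
  by rewrite rmorphB /=; ring.
suff -> : Num.floor (x - y + (k - l)%:~R + 2^-1) = k - l by rewrite addrK.
by apply: floor_def; rewrite rmorphD /=; lra.
Qed.

(** By continuity [F (x0 + t) - F x0] has modulus below [1/2] for small [t], so there [csub] returns
    exactly this difference. The two functions of [t] agree near [0] and have the same
    derivative. *)
Lemma cderiv_lift (g : circle R -> circle R) (F : R -> R) z (d : R) :
  (forall x, g (circle_proj x) = circle_proj (F x)) ->
  is_derive (repr z) 1 F d -> cderiv g z = d.
Proof.
move=> gF dF.
rewrite /cderiv derive1E.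
set x0 := repr z.
have gz : g z = circle_proj (F x0) by rewrite -gF circle_reprK.
have cF : {for x0, continuous F}.
  by apply: differentiable_continuous; apply/derivable1_diffP; case: dF.
have -> : 'D_1 (fun t => csub (g (circle_translate z t)) (g z)) 0 =
          'D_1 (fun t => F (x0 + t) - F x0) 0.
  apply: near_eq_derive.
  rewrite gz.
  have h : \forall u \near x0, `|F x0 - F u| < 2^-1.
    by move/cvgrPdist_lt: cF; apply; rewrite invr_gt0.
  have : \forall t \near (0:R), `|F x0 - F (x0 + t)| < 2^-1.
    have ct : (fun t : R => x0 + t) @ 0 --> x0.
      by rewrite -[X in _ --> X]addr0; apply: cvgD; [exact: cvg_cst|exact: cvg_id].
    exact: (ct _ h).
  apply: filterS => t ht; rewrite /circle_translate gF csub_proj//.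
  by move: ht; rewrite ltr_distl => /andP[]; lra.
have dF' : is_derive (x0 + 0) 1 F d by rewrite addr0.
have dG : is_derive (0 : R) 1 (fun t => x0 + t) 1.
  have := is_deriveD (is_derive_cst x0 (0:R) 1) (is_derive_id (0:R) 1).
  by rewrite add0r.
have [dFG vFG] := @is_derive1_comp _ F (fun t => x0 + t) 0 _ _ dF' dG.
have := @deriveB _ _ _ _ (cst (F x0)) _ _ dFG (derivable_cst _ _ _).
by rewrite vFG derive_cst subr0 mulr1.
Qed.

End circle_lift.

Section lift.
Context {R : realType} (L a : R).
Implicit Types (x : R) (t : nat -> R).

(** The noise is an arbitrary real sequence rather than a point of [noise_seq], so that finite words
    can be built and perturbed freely. *)
Fixpoint clift t n x : R :=
  if n is m.+1 then L * sin (2 * pi * (clift t m x + t m)) + a else x.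

Definition dstep x s : R := 2 * pi * L * cos (2 * pi * (x + s)).

Fixpoint dclift t n x : R :=
  if n is m.+1 then dclift t m x * dstep (clift t m x) (t m) else 1.

Lemma is_derive_step s x :
  is_derive x 1 (fun y : R => L * sin (2 * pi * (y + s)) + a) (dstep x s).
Proof.
have d1 : is_derive x 1 (fun y : R => 2 * pi * (y + s)) (2 * pi).
  have := is_deriveZ (2 * pi) (is_deriveD (is_derive_id x 1) (is_derive_cst s x 1)).
  by rewrite addr0 /GRing.scale /= mulr1.
have d2 := @is_derive1_comp _ sin _ x _ _ (is_derive_sin _) d1.
have d3 := is_deriveD (is_deriveZ L d2) (is_derive_cst a x 1).
by apply: (is_derive_eq d3); rewrite addr0 /GRing.scale /= /dstep; ring.
Qed.

Lemma is_derive_clift t n x : is_derive x 1 (clift t n) (dclift t n x).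
Proof.
elim: n => [|n IH] /=; first exact: is_derive_id.
apply: (is_derive_eq (@is_derive1_comp _ _ (clift t n) x _ _ (is_derive_step (t n) _) IH)).
exact: mulrC.
Qed.

Lemma circle_map_proj s x :
  circle_map L a s (circle_proj x) = circle_proj (L * sin (2 * pi * (x + s)) + a).
Proof.
rewrite /circle_map; have [k ->] := repr_circle_proj x.
by rewrite addrAC sin_int.
Qed.

Lemma circle_iter_proj (s : {posnum R}) (w : noise_seq s) n x :
  circle_iter L a w n (circle_proj x) =
  circle_proj (clift (fun i => noise_coord i w) n x).
Proof. by elim: n => //= n ->; rewrite circle_map_proj. Qed.

Lemma cderiv_circle_iter (s : {posnum R}) (w : noise_seq s) n z :
  cderiv (circle_iter L a w n) z = dclift (fun i => noise_coord i w) n (repr z).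
Proof.
apply: cderiv_lift; last exact: is_derive_clift.
exact: circle_iter_proj.
Qed.

End lift.

(** * The product measure *)

Section noise_measurability.
Context {R : realType} (s : {posnum R}).

Lemma measurable_noise_coord i :
  measurable_fun setT (@noise_coord R s i : noise_seq s -> measurableTypeR R).
Proof.
move=> _ A mA; rewrite setTI; apply: sub_sigma_algebra.
by exists i, A.
Qed.

Lemma measurable_fun_noise_seq d (T : measurableType d) (f : T -> noise_seq s) :
  (forall i, measurable_fun setT (fun x => noise_coord i (f x) : measurableTypeR R)) ->
  measurable_fun setT f.
Proof.
move=> mf; apply: (measurability (@noise_coord_preimages R s)) => //.
by move=> _ [_ [i [A mA ->]] <-]; exact: (mf i measurableT A mA).
Qed.

Definition splice n (w w' : noise_seq s) : noise_seq s :=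
  fun i => if (i < n)%N then w i else w' (i - n)%N.

Lemma measurable_splice n :
  measurable_fun setT (fun ww : noise_seq s * noise_seq s => splice n ww.1 ww.2).
Proof.
apply: measurable_fun_noise_seq => i; rewrite /splice /noise_coord.
case: (i < n)%N.
- exact: (measurableT_comp (measurable_noise_coord i) measurable_fst).
- exact: (measurableT_comp (measurable_noise_coord (i - n)) measurable_snd).
Qed.

Lemma measurable_noise_shift n :
  measurable_fun setT (iter n (@noise_shift R s)).
Proof.
elim: n => [|n IH] /=; first exact: measurable_id.
apply: measurable_fun_noise_seq => i.
exact: (measurableT_comp (measurable_noise_coord i.+1) IH).
Qed.

Lemma iter_noise_shiftE n (w : noise_seq s) i : iter n (@noise_shift R s) w i = w (n + i)%N.
Proof. by elim: n i => //= n IH i; rewrite /noise_shift IH addnS. Qed.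

Lemma noise_shift_splice n (w w' : noise_seq s) :
  iter n (@noise_shift R s) (splice n w w') = w'.
Proof.
apply/funext => i; rewrite iter_noise_shiftE /splice.
by rewrite ltnNge leq_addr/= addKn.
Qed.

Definition box n (A : nat -> set R) : set (noise_seq s) :=
  [set w | forall i, (i < n)%N -> A i (noise_coord i w)].

Lemma measurable_box n (A : nat -> set R) : (forall i, measurable (A i)) ->
  measurable (box n A).
Proof.
move=> mA.
have -> : box n A = \big[setI/setT]_(i < n) (noise_coord i @^-1` A i).
  rewrite -(bigcap_mkord n (fun i => noise_coord i @^-1` A i)).
  by apply/seteqP; split => w h i /h.
apply: bigsetI_measurable => i _.
by rewrite -[X in measurable X]setTI; exact: (measurable_noise_coord i measurableT (mA i)).
Qed.

Definition boxes : set (set (noise_seq s)) :=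
  [set C | exists n, exists2 A : nat -> set R, (forall i, measurable (A i)) & C = box n A].

Lemma boxesI : setI_closed boxes.
Proof.
move=> _ _ [n [A mA ->]] [m [B mB ->]].
exists (maxn n m), (fun i => (if (i < n)%N then A i else setT) `&`
                             (if (i < m)%N then B i else setT)).
  by move=> i; apply: measurableI; case: ifP.
apply/seteqP; split => w.
- by move=> [hA hB] i _; split; case: ifP => // h; [exact: hA|exact: hB].
- move=> h; split => i lei.
  + by have := (h i); rewrite leq_max lei => /(_ isT)[].
  + by have := (h i); rewrite leq_max lei orbT => /(_ isT)[].
Qed.

Lemma measurable_boxesE : @measurable _ (noise_seq s) = <<s boxes >>.
Proof.
apply/seteqP; split.
- apply: smallest_sub; first exact: smallest_sigma_algebra.
  move=> _ [i [A mA ->]]; apply: sub_sigma_algebra.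
  exists i.+1, (fun j => if j == i then A else setT); first by move=> j; case: ifP.
  apply/seteqP; split => w /=; first by move=> Aw j _; case: eqP => // ->.
  by move=> /(_ i (ltnSn i)); rewrite eqxx.
- apply: smallest_sub; first exact: sigma_algebra_measurable.
  by move=> _ [n [A mA ->]]; exact: measurable_box.
Qed.

Variables (P : probability (noise_seq s) R) (PP : is_product_measure P).

(** Past and future are independent: drawing them from two independent copies gives the same law.
    Both measures agree on boxes, which are stable under intersection and generate the
    sigma-algebra, so they coincide. *)
Lemma splice_measure (C : set (noise_seq s)) n : measurable C ->
  (P \x P)%E ((fun ww : noise_seq s * noise_seq s => splice n ww.1 ww.2) @^-1` C) = P C.
Proof.
move=> mC; apply/esym.
pose Q := pushforward (P \x P)%E (fun ww : noise_seq s * noise_seq s => splice n ww.1 ww.2).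
have PQ : forall C, boxes C -> P C = Q C.
  move=> _ [m [A mA ->]].
  (* Padding with [setT] up to length [n + m] lets the box be cut at [n], also when [m] is at most
     [n]. *)
  pose A' i := if (i < m)%N then A i else setT.
  have mA' i : measurable (A' i) by rewrite /A'; case: ifP.
  have -> : box m A = box (n + m) A'.
    apply/seteqP; split => w h i; first by rewrite /A'; case: ifP => // im _; exact: h.
    by move=> im; have := h i; rewrite /A' im; apply; rewrite ltn_addl.
  rewrite /Q /pushforward [X in (_ \x _)%E X](_ : _ = box n A' `*` box m (fun i => A' (n + i)%N)).
    rewrite product_measure1E; [|exact: measurable_box..].
    rewrite [LHS](PP (n + m)%N mA') big_split_ord; congr (_ * _)%E; apply/esym.
      exact: (PP n mA').
    exact: (PP m (fun i => mA' (n + i)%N)).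
  apply/seteqP; split => -[w w'] /=.
  + move=> h; split => i im.
      by have := h i (ltn_addr _ im); rewrite /splice /noise_coord im.
    have := h (n + i)%N; rewrite ltn_add2l im /splice /noise_coord => /(_ isT).
    by rewrite ltnNge leq_addr/= addKn.
  + move=> [h h'] i im; rewrite /splice /noise_coord.
    case: ifPn => [|]; first exact: h.
    rewrite -leqNgt => ni; have := h' (i - n)%N; rewrite subnKC//; apply.
    by rewrite ltn_subLR.
have bT : boxes setT.
  exists 0%N, (fun=> setT) => //.
  by apply/seteqP; split.
pose M := measure_function_pushforward__canonical__measure_function_Measure
    (P \x P)%E (measurable_splice n).
have covT : \bigcup_(k : nat) (setT : set (noise_seq s)) = setT.
  by apply/seteqP; split => // x _; exists 0%N.
have fT : forall k : nat, (P setT < +oo)%E by move=> _; rewrite probability_setT ltry.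
exact: (@measure_unique _ R _ _ (fun=> setT) measurable_boxesE boxesI
  (fun=> bT) covT P M PQ fT C mC).
Qed.

End noise_measurability.

Section product_measure_integration.
Context {R : realType} (s : {posnum R}).
Variables (P : probability (noise_seq s) R) (PP : is_product_measure P).
Local Open Scope ereal_scope.

(** Change of variables under [splice], then Tonelli: the inner integral averages over the future
    with the past [w] frozen. *)
Lemma integral_splice n (F : noise_seq s -> \bar R) :
  measurable_fun setT F -> (forall w, 0 <= F w) ->
  \int[P]_w F w = \int[P]_w \int[P]_w' F (splice n w w').
Proof.
move=> mF F0.
rewrite (eq_measure_integral
  (measure_function_pushforward__canonical__measure_function_Measure
    (P \x P)%E (measurable_splice n))); last first.
  by move=> A mA _; exact/esym/(splice_measure PP n mA).
rewrite ge0_integral_pushforward//; last exact: measurable_splice.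
rewrite preimage_setT fubini_tonelli1// => [|ww]; last exact: F0.
exact: (measurableT_comp mF (measurable_splice n)).
Qed.

(* Independence enters only here: [splice] separates the first [b * n]
   coordinates from the following ones. *)
Lemma integral_prod_le (b : nat) (X : nat -> noise_seq s -> \bar R)
    (g : nat -> noise_seq s -> noise_seq s -> \bar R) (rho : R) :
  (0 < rho)%R ->
  (forall w, X 0%N w = 1) ->
  (forall n, measurable_fun setT (X n)) -> (forall n w, 0 <= X n w) ->
  (forall n w, measurable_fun setT (g n w)) -> (forall n w w', 0 <= g n w w') ->
  (forall n w w', X n.+1 (splice (b * n) w w') = X n w * g n w w') ->
  (forall n w, \int[P]_w' g n w w' <= rho%:E) ->
  forall n, \int[P]_w X n w <= (rho ^+ n)%:E.
Proof.
move=> rho0 X0 mX X_ge0 mg g0 Xg gle; elim=> [|n IH].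
  under eq_integral do rewrite X0.
  by rewrite integral_cst// expr0 mul1e; have := probability_setT P; rewrite /= => ->.
rewrite (integral_splice (b * n))//.
apply: (@le_trans _ _ (\int[P]_w (rho%:E * X n w))).
  apply: ge0_le_integral => //.
  - by move=> w _; exact: integral_ge0.
  - apply: (measurable_fun_fubini_tonelli_F
      (fun ww : noise_seq s * noise_seq s => X n.+1 (splice (b * n) ww.1 ww.2))) => //.
    exact: (measurableT_comp (mX n.+1) (measurable_splice _)).
  - exact: measurable_funeM.
  - move=> w _; under eq_integral do rewrite Xg.
    (* A finite [X n w] comes out of the inner integral; if it is [+oo], the bound [rho * X n w] is
       [+oo] because [rho > 0]. *)
    have := X_ge0 n w; case: (X n w) => [r r0| _ |//].
    + rewrite ge0_integralZl_EFin// [leRHS]muleC lee_wpmul2l//.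
    + by rewrite gt0_muley ?lte_fin// leey.
rewrite ge0_integralZl_EFin//; last exact: ltW.
by rewrite exprS EFinM lee_pmul2l// ?lte_fin.
Qed.

End product_measure_integration.

(** * Markov's inequality and Borel-Cantelli *)

Section eventually_le.
Context d (T : measurableType d) {R : realType} (mu : {measure set T -> \bar R}).
Local Open Scope ereal_scope.

(** By Markov's inequality the set where [X n] is at least [q ^ n] has measure at most
    [(r / q) ^ n]. This is summable, so by Borel-Cantelli almost every point lies in finitely many
    of these sets. *)
Lemma ae_eventually_le (X : nat -> T -> \bar R) (r q : R) :
  (0 < r)%R -> (r < q)%R ->
  (forall n, measurable_fun setT (X n)) -> (forall n w, 0 <= X n w) ->
  (forall n, \int[mu]_w X n w <= (r ^+ n)%:E) ->
  {ae mu, forall w, exists n0, forall n, (n0 <= n)%N -> X n w <= (q ^+ n)%:E}.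
Proof.
move=> r0 rq mX X0 Xr.
have q0 : (0 < q)%R by exact: lt_trans rq.
pose F n := [set w | (q ^+ n)%:E <= X n w].
have mF n : measurable (F n).
  by rewrite -[F n]setTI; exact: emeasurable_fun_c_infty.
have muF n : mu (F n) <= ((r / q) ^+ n)%:E.
  have := @le_integral_comp_abse _ _ _ mu setT measurableT (X n) (q ^+ n)%R id
    (@measurable_id _ _ setT) (fun r r0 => r0) (fun x y _ _ xy => xy) (mX n)
    (exprn_gt0 n q0).
  rewrite setTI expr_div_n EFinM lee_pdivlMr ?exprn_gt0// muleC.
  have -> : [set x | (q ^+ n)%:E <= `|X n x|] = F n.
    by apply/seteqP; split => w; rewrite /F /= gee0_abs.
  under eq_integral do rewrite gee0_abs//.
  by move=> /le_trans; apply.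
have F0 : mu (lim_sup_set F) = 0.
  apply: lim_sup_set_cvg0 => //.
  apply: (@le_lt_trans _ _ (\sum_(n <oo) ((r / q) ^+ n)%:E)).
    by apply: lee_nneseries.
  apply: (@le_lt_trans _ _ ((1 - r / q)^-1)%:E); last exact: ltry.
  apply: lime_le.
    by apply: is_cvg_nneseries => n _ _; rewrite lee_fin exprn_ge0// divr_ge0 ?ltW.
  apply: nearW => n; rewrite sumEFin lee_fin.
  have rq1 : (0 < r / q)%R by rewrite divr_gt0.
  have := @geometric_le_lim R n 1 (r / q) ler01 rq1.
  rewrite gtr0_norm// ltr_pdivrMr// !mul1r => /(_ rq).
  apply: le_trans; rewrite seriesEnat/= le_eqVlt; apply/orP; left; apply/eqP.
  by apply: eq_bigr => i _; rewrite mul1r.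
exists (lim_sup_set F); split => //.
  by apply: bigcap_measurable => // k _; exact: bigcup_measurable.
move=> w /= hw; apply: contrapT => nF; apply: hw.
have [n0 hn0] : exists n0, forall j, (n0 <= j)%N -> ~ F j w.
  apply: contrapT => h; apply: nF => n0 _.
  apply: contrapT => h'; apply: h; exists n0 => j jn0 Fj; apply: h'.
  by exists j.
exists n0 => n /hn0 /negP; rewrite /F /= -ltNge; exact: ltW.
Qed.

End eventually_le.

(** * The one-step moment estimate *)

Section inverse_sqrt.
Context {R : realType}.
Implicit Types (x y t b c : R).

(* [|y|^(-1/2)]; the value [+oo] at [0] replaces the junk value of the real inverse. *)
Definition invsqrt y : \bar R :=
  if y == 0 then +oo%E else ((Num.sqrt `|y|)^-1)%:E.

Lemma invsqrt_gt0 y : (0 < invsqrt y)%E.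
Proof.
rewrite /invsqrt; case: ifPn => // y0.
by rewrite lte_fin invr_gt0 sqrtr_gt0 normr_gt0.
Qed.

Lemma invsqrt_ge0 y : (0 <= invsqrt y)%E. Proof. exact: ltW (invsqrt_gt0 y). Qed.

(** All values are positive, so a factor [+oo] makes the product [+oo], and multiplicativity
    survives at zeros. The chain rule thus becomes a product of one-step factors. *)
Lemma invsqrtM x y : invsqrt (x * y) = (invsqrt x * invsqrt y)%E.
Proof.
have [->|x0] := eqVneq x 0.
  by rewrite mul0r [in RHS]/invsqrt eqxx gt0_mulye ?invsqrt_gt0// /invsqrt eqxx.
have [->|y0] := eqVneq y 0.
  by rewrite mulr0 [invsqrt 0]/invsqrt eqxx gt0_muley ?invsqrt_gt0.
by rewrite /invsqrt mulf_eq0 (negbTE x0) (negbTE y0)/= normrM sqrtrM// invfM EFinM.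
Qed.

Lemma invsqrt1 : invsqrt 1 = 1%E.
Proof. by rewrite /invsqrt oner_eq0 normr1 sqrtr1 invr1. Qed.

Lemma invsqrt_le x y : `|x| <= `|y| -> (invsqrt y <= invsqrt x)%E.
Proof.
rewrite /invsqrt => xy; case: (eqVneq x 0) => [_|x0]; first by rewrite leey.
have x0' : 0 < `|x| by rewrite normr_gt0.
have y0' : 0 < `|y| by exact: lt_le_trans xy.
by rewrite -normr_eq0 gt_eqF// lee_fin lef_pV2 ?posrE ?sqrtr_gt0// ler_sqrt.
Qed.

Lemma measurable_invsqrt : measurable_fun [set: R] invsqrt.
Proof.
apply: measurable_fun_ifT => //; first exact: measurable_fun_eqr.
apply/measurable_EFinP.
have -> : (fun y : R => (Num.sqrt `|y|)^-1) = (fun y => powR `|y| (- 2^-1)).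
  by apply/funext => y; rewrite powRN powR12_sqrt.
exact: (measurableT_comp (measurable_powR _)).
Qed.

(* [f] may be unbounded near the end points. *)
Lemma integral_oo_le_primitive (f F : R -> R) a b (M : R) : a < b ->
  measurable_fun [set: R] f ->
  {in `]a, b[, continuous f} -> {in `]a, b[, forall x, 0 <= f x} ->
  {in `]a, b[, forall x, is_derive x 1 F (f x)} ->
  {in `]a, b[ &, forall x y, x <= y -> F y - F x <= M} ->
  (\int[lebesgue_measure]_(x in `]a, b[) (f x)%:E <= M%:E)%E.
Proof.
move=> ab mf cf f0 dF FM.
(* The denominator is at least [3], so that [e n + e n < b - a] and every [J n] below is a
   nondegenerate compact interval. *)
pose e n : R := (b - a) / n.+3%:R.
have ba : 0 < b - a by rewrite subr_gt0.
have e0 n : 0 < e n by rewrite divr_gt0.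
have elt n : e n + e n < b - a.
  rewrite -mulr2n -[_ *+ 2]mulr_natl /e mulrCA -[ltRHS]mulr1 ltr_pM2l//.
  by rewrite ltr_pdivrMr// mul1r ltr_nat.
pose J n : set R := `[a + e n, b - e n]%classic.
have eJ n x : J n x -> x \in `]a, b[.
  rewrite /J /= !in_itv /= => /andP[h1 h2]; have := e0 n; lra.
have Uab : `]a, b[%classic = \bigcup_n J n.
  apply/seteqP; split => [x|x [n _]]; last exact: eJ.
  rewrite /= in_itv /= => /andP[ax xb].
  pose d := Num.min (x - a) (b - x).
  have d0 : 0 < d by rewrite lt_min !subr_gt0 ax xb.
  have [n hn] : exists n : nat, (b - a) / d < n%:R.
    by exists (Num.truncn ((b - a) / d)).+1; exact: truncnS_gt.
  have en : e n <= d.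
    rewrite /e ler_pdivrMr// mulrC -ler_pdivrMr// (le_trans (ltW hn))// ler_nat.
    by rewrite -addn3 leq_addr.
  exists n => //; rewrite /J /= in_itv /=.
  move: en; rewrite le_min => /andP[]; lra.
rewrite Uab.
(* Monotone convergence along the increasing intervals [J n]; on each of them the fundamental
   theorem of calculus applies and gives at most [M]. *)
have cvgJ := @ge0_nondecreasing_set_cvg_integral _ (measurableTypeR R) R J (EFin \o f)
  lebesgue_measure.
apply: (cvge_le _ (cvgJ _ _ _ _)) => //.
- apply: nearW => n.
  have en := e0 n; have en2 := elt n.
  have lt1 : a + e n < b - e n by lra.
  have sub x : x \in `[a + e n, b - e n] -> x \in `]a, b[ by exact: eJ.
  rewrite (@continuous_FTC2 _ f F)//.
  + by rewrite -EFinB lee_fin; apply: FM; [apply: sub; rewrite in_itv/= lexx ltW|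
      apply: sub; rewrite in_itv/= lexx ltW|exact: ltW].
  + by apply: continuous_in_subspaceT => x /[!inE] /sub/cf.
  + have cF x : x \in `[a + e n, b - e n] -> {for x, continuous F}.
      move=> /sub/dF dFx; apply: differentiable_continuous.
      by apply/derivable1_diffP; case: dFx.
    split.
    * by move=> x xJ; case: (dF x (sub x (subset_itv_oo_cc xJ))).
    * by apply: cvg_at_right_filter; apply: cF; rewrite in_itv/= lexx ltW.
    * by apply: cvg_at_left_filter; apply: cF; rewrite in_itv/= lexx ltW.
  + move=> x xJ; rewrite derive1E.
    by case: (dF x (sub x (subset_itv_oo_cc xJ))) => _ ->.
- move=> n m nm; rewrite subsetEset => x; rewrite /J/= !in_itv/=.
  have : e m <= e n.
    by rewrite ler_pM2l// lef_pV2 ?posrE// ler_nat.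
  lra.
- by move=> n; exact: measurable_itv.
- by move=> n; apply: measurable_funTS; apply/measurable_EFinP.
- by move=> n x /eJ/f0; rewrite lee_fin.
Qed.

Let mu := @lebesgue_measure R.

Lemma measurable_invsqrtB b : measurable_fun [set: measurableTypeR R] (fun t => invsqrt (t - b)).
Proof.
by apply: (measurableT_comp measurable_invsqrt); exact: measurable_funB.
Qed.

Lemma continuous_sqrtB b : continuous (fun t : R => Num.sqrt (t - b)).
Proof.
move=> t; apply: (@continuous_comp _ _ _ (fun t => t - b) Num.sqrt).
  by apply: cvgB; [exact: cvg_id|exact: cvg_cst].
exact: sqrt_continuous.
Qed.

Lemma continuous_sqrtN b : continuous (fun t : R => Num.sqrt (b - t)).
Proof.
move=> t; apply: (@continuous_comp _ _ _ (fun t => b - t) Num.sqrt).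
  by apply: cvgB; [exact: cvg_cst|exact: cvg_id].
exact: sqrt_continuous.
Qed.

Lemma measurable_sqrtV (g : R -> R) : continuous g ->
  measurable_fun [set: R] (fun t => (g t)^-1).
Proof.
move=> cg; have mg := continuous_measurable_fun cg.
have mV : measurable_fun [set: R] (@GRing.inv R).
  have -> : @GRing.inv R = fun y => if 0 <= y then powR y (-1) else - powR (- y) (-1).
    apply/funext => y; case: (leP 0 y) => y0; first by rewrite powR_inv1.
    by rewrite powR_inv1 ?oppr_ge0 ?ltW// invrN opprK.
  apply: measurable_fun_ifT => //=; first exact: measurable_fun_ler.
  apply: (measurableT_comp (@oppr_measurable R setT)).
  by apply: (measurableT_comp (measurable_powR _)); exact: oppr_measurable.
exact: measurableT_comp.
Qed.

Lemma sqrtB_le x y : 0 <= x -> x <= y -> Num.sqrt y - Num.sqrt x <= Num.sqrt (y - x).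
Proof.
move=> x0 xy; have y0 := le_trans x0 xy.
rewrite lerBlDr -(@ler_pXn2r _ 2)// ?nnegrE ?addr_ge0 ?sqrtr_ge0//.
rewrite sqrrD !sqr_sqrtr ?subr_ge0//.
have : 0 <= Num.sqrt (y - x) * Num.sqrt x by rewrite mulr_ge0 ?sqrtr_ge0.
rewrite mulr2n; lra.
Qed.

(** A primitive is [2 * Num.sqrt (t - b)], and its increments are controlled by subadditivity of the
    square root. *)
Lemma integral_invsqrt_right b c d : b <= c -> c < d ->
  (\int[mu]_(t in `]c, d[) invsqrt (t - b) <= (2 * Num.sqrt (d - c))%:E)%E.
Proof.
move=> bc cd.
rewrite (@eq_integral _ (measurableTypeR R) R mu `]c, d[%classic
  (fun t : R => ((Num.sqrt (t - b))^-1)%:E)); last first.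
  move=> t; rewrite inE/= in_itv/= => /andP[ct td].
  have tb : 0 < t - b by rewrite subr_gt0; exact: le_lt_trans ct.
  by rewrite /invsqrt gt_eqF// gtr0_norm.
apply: (@integral_oo_le_primitive _ (fun t => 2 * Num.sqrt (t - b))) => //.
- by apply: measurable_sqrtV; exact: continuous_sqrtB.
- move=> t; rewrite in_itv/= => /andP[ct td].
  apply: cvgV; last exact: continuous_sqrtB.
  by rewrite gt_eqF// sqrtr_gt0 subr_gt0; exact: le_lt_trans ct.
- move=> t; rewrite in_itv/= => /andP[ct td].
  have tb : 0 < t - b by rewrite subr_gt0; exact: le_lt_trans ct.
  have d1 := is_deriveB (is_derive_id t 1) (is_derive_cst b t 1).
  have d2 := @is_derive1_comp _ Num.sqrt _ t _ _ (is_derive1_sqrt tb) d1.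
  apply: (is_derive_eq (is_deriveZ 2 d2)).
  rewrite subr0 mulr1 /GRing.scale /= invfM mulrA divff ?mul1r//.
- move=> x y; rewrite !in_itv/= => /andP[cx xd] /andP[cy yd] xy.
  rewrite -mulrBr ler_pM2l//; apply: le_trans (sqrtB_le _ _) _; [lra..|].
  by rewrite ler_wsqrtr//; lra.
Qed.

Lemma integral_invsqrt_left b c d : d <= b -> c < d ->
  (\int[mu]_(t in `]c, d[) invsqrt (t - b) <= (2 * Num.sqrt (d - c))%:E)%E.
Proof.
move=> bc cd.
rewrite (@eq_integral _ (measurableTypeR R) R mu `]c, d[%classic
  (fun t : R => ((Num.sqrt (b - t))^-1)%:E)); last first.
  move=> t; rewrite inE/= in_itv/= => /andP[ct td].
  have tb : t - b < 0 by rewrite subr_lt0; exact: lt_le_trans td bc.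
  by rewrite /invsqrt lt_eqF// ltr0_norm// opprB.
apply: (@integral_oo_le_primitive _ (fun t => - 2 * Num.sqrt (b - t))) => //.
- by apply: measurable_sqrtV; exact: continuous_sqrtN.
- move=> t; rewrite in_itv/= => /andP[ct td].
  apply: cvgV; last exact: continuous_sqrtN.
  by rewrite gt_eqF// sqrtr_gt0 subr_gt0; exact: lt_le_trans bc.
- move=> t; rewrite in_itv/= => /andP[ct td].
  have tb : 0 < b - t by rewrite subr_gt0; exact: lt_le_trans bc.
  have d1 := is_deriveB (is_derive_cst b t 1) (is_derive_id t 1).
  have d2 := @is_derive1_comp _ Num.sqrt _ t _ _ (is_derive1_sqrt tb) d1.
  apply: (is_derive_eq (is_deriveZ (-2) d2)).
  by rewrite sub0r mulrN1 /GRing.scale /= mulrNN invfM mulrA divff ?mul1r.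
- move=> x y; rewrite !in_itv/= => /andP[cx xd] /andP[cy yd] xy.
  rewrite -mulrBr mulNr -mulrN opprB ler_pM2l//; apply: le_trans (sqrtB_le _ _) _; [lra..|].
  by rewrite ler_wsqrtr//; lra.
Qed.

(** If [b] lies inside, cut there: with [u], [v] the roots of the two lengths,
    [u ^+ 2 + v ^+ 2 = 2 * s], hence [(u + v) ^+ 2 <= 4 * s]. If [b] lies outside, one side
    suffices. *)
Lemma integral_invsqrt (s b : R) : 0 < s ->
  (\int[mu]_(t in `[(- s)%R, s]) invsqrt (t - b) <= (4 * Num.sqrt s)%:E)%E.
Proof.
move=> s0; have sNs : - s < s by lra.
have mI (A : set (measurableTypeR R)) : measurable_fun A (fun t => invsqrt (t - b)).
  by apply: measurable_funTS; exact: measurable_invsqrtB.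
rewrite integral_itv_bndoo; last exact: mI.
have sqrt2 : 2 * Num.sqrt (s - - s) <= 4 * Num.sqrt s.
  rewrite opprK -(@ler_pXn2r _ 2)// ?nnegrE ?mulr_ge0 ?sqrtr_ge0//.
  rewrite !exprMn !sqr_sqrtr ?addr_ge0 ?ltW//; lra.
case: (leP b (- s)) => [bs|sb].
  apply: (le_trans (integral_invsqrt_right bs sNs)).
  by rewrite lee_fin.
case: (leP s b) => [bs|bs].
  apply: (le_trans (integral_invsqrt_left bs sNs)).
  by rewrite lee_fin.
have -> : `]- s, s[%classic = (`]- s, b] `|` `]b, s[)%classic.
  apply/seteqP; split => t /=; rewrite !in_itv/=.
    by move=> /andP[-> ->]; rewrite andbT; case: (leP t b) => ?; [left|right].
  by case=> /andP[h1 h2]; apply/andP; split; lra.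
rewrite ge0_integral_setU//=; last 2 first.
- by move=> t _; exact: invsqrt_ge0.
- rewrite disj_set2E; apply/eqP/seteqP; split => t //=; rewrite !in_itv/=.
  by move=> [/andP[_ h] /andP[h' _]]; lra.
rewrite (@integral_itv_bndoo _ (- s) b _ false false); last exact: mI.
apply: (le_trans (leeD (integral_invsqrt_left (lexx b) sb)
  (integral_invsqrt_right (lexx b) bs))).
rewrite -EFinD lee_fin opprK.
set u := Num.sqrt (b + s); set v := Num.sqrt (s - b).
have u2 : u ^+ 2 = b + s by rewrite sqr_sqrtr; lra.
have v2 : v ^+ 2 = s - b by rewrite sqr_sqrtr; lra.
have u0 : 0 <= u by exact: sqrtr_ge0.
have v0 : 0 <= v by exact: sqrtr_ge0.
rewrite -(@ler_pXn2r _ 2)// ?nnegrE ?addr_ge0 ?mulr_ge0 ?sqrtr_ge0//.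
rewrite exprMn sqr_sqrtr ?(ltW s0)//.
have := sqr_ge0 (u - v); nra.
Qed.

End inverse_sqrt.

(** * Lower bounds for the sine and the cosine *)

Section trigonometric_bounds.
Context {R : realType}.
Implicit Types (x y u v d : R).

Lemma sin_MVT x : 0 < x -> exists2 y, 0 < y < x & sin x = cos y * x.
Proof.
move=> x0; have [|c] := @MVT _ sin cos 0 x x0 (fun y _ => is_derive_sin y).
  exact/continuous_subspaceT/continuous_sin.
by rewrite in_itv/= sin0 !subr0 => cx ->; exists c.
Qed.

Lemma sin_le_id x : 0 <= x -> sin x <= x.
Proof.
rewrite le_eqVlt => /predU1P[<-|x0]; first by rewrite sin0.
have [y _ ->] := sin_MVT x0.
by rewrite ler_piMl ?cos_le1// ltW.
Qed.

(** Since [cos (2 pi / 3) = - cos (pi / 3)], the duplication formula makes [c = cos (pi / 3)] a root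
    of [(2 c - 1) (c + 1)], and [c] is positive. *)
Lemma cos_pithird : cos (pi / 3) = 2^-1 :> R.
Proof.
have p0 := @pi_gt0 R.
have c0 : 0 < cos (pi / 3 : R) by apply: cos_gt0_pihalf; apply/andP; split; lra.
have e : cos (pi / 3 *+ 2) = - cos (pi / 3) :> R.
  have -> : pi / 3 *+ 2 = - (pi / 3) + pi :> R by rewrite mulr2n; field.
  by rewrite cosDpi cosN.
rewrite cos_mulr2n mulr2n in e.
have : (2 * cos (pi / 3) - 1) * (cos (pi / 3) + 1) = 0 :> R by lra.
by move/eqP; rewrite mulf_eq0 => /orP[|] /eqP; lra.
Qed.

(** From [1/2 = sin (pi / 6) <= pi / 6]. *)
Lemma pi_ge3 : 3 <= pi :> R.
Proof.
have p0 := @pi_gt0 R.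
have e : sin (pi / 6) = 2^-1 :> R.
  by rewrite -cosBpihalf -cosN -[RHS]cos_pithird; congr cos; field.
have p6 : 0 <= pi / 6 :> R by lra.
by have := sin_le_id p6; rewrite e; lra.
Qed.

(** By the mean value theorem [sin x = x cos y] with [0 < y < x], and [cos y >= cos x = 1 - 2 sin^2
    (x / 2) >= 1 - x^2 / 2]. *)
Lemma sin_ge_near0 x : 0 <= x <= 1 -> x * (1 - x ^+ 2 / 2) <= sin x.
Proof.
move=> /andP[]; rewrite le_eqVlt => /predU1P[<- _|x0 x1]; first by rewrite sin0 mul0r.
have [y /andP[y0 yx] ->] := sin_MVT x0.
rewrite mulrC ler_pM2r//.
have pi3 := pi_ge3.
have cyx : cos x <= cos y.
  by rewrite ltW// ltr_cos// in_itv/=; apply/andP; split; lra.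
apply: le_trans cyx.
have -> : cos x = 1 - 2 * sin (x / 2) ^+ 2.
  rewrite {1}(_ : x = x / 2 *+ 2); last by rewrite -mulr_natr; field.
  by rewrite cos_mulr2n cos2sin2 mulr2n; ring.
have s0 : 0 <= sin (x / 2) by apply: sin_ge0_pi; apply/andP; split; lra.
have sx : sin (x / 2) <= x / 2 by apply: sin_le_id; lra.
nra.
Qed.

(* Jordan's inequality: by the mean value theorem and the monotonicity of the cosine, the
   chord of the sine over [[0, z]] is steeper than the one over [[z, pi / 2]]. *)
Lemma sin_ge_chord y : 0 <= y <= 4^-1 -> 4 * y <= sin (2 * pi * y).
Proof.
move=> /andP[]; rewrite le_eqVlt => /predU1P[<- _|y0].
  by rewrite !mulr0 sin0.
rewrite le_eqVlt => /predU1P[->|y4].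
  have -> : 2 * pi * 4^-1 = pi / 2 :> R by field.
  by rewrite sin_pihalf mulfV.
have p0 := @pi_gt0 R.
set z := 2 * pi * y.
have z0 : 0 < z by rewrite !mulr_gt0.
have zp : z < pi / 2 by rewrite /z; nra.
have [c1 + h1] := @MVT _ sin cos 0 z z0 (fun y _ => is_derive_sin y)
  (continuous_subspaceT (@continuous_sin R)).
have [c2 + h2] := @MVT _ sin cos z (pi / 2) zp (fun y _ => is_derive_sin y)
  (continuous_subspaceT (@continuous_sin R)).
rewrite !in_itv/= => /andP[c2z c2p] /andP[c10 c1z].
have cc : cos c2 < cos c1.
  by rewrite ltr_cos ?in_itv/=; [lra|apply/andP; split; lra..].
rewrite sin0 !subr0 in h1; rewrite sin_pihalf in h2.
have e : cos c1 * z + cos c2 * (pi / 2 - z) = 1 by rewrite -h1 -h2; ring.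
have le12 : cos c2 * (pi / 2 - z) <= cos c1 * (pi / 2 - z).
  by rewrite ler_pM2r ?subr_gt0// ltW.
have ph : 0 < pi / 2 :> R by lra.
have zE : z = 2 * pi * y by [].
rewrite -(ler_pM2l ph) h1; nra.
Qed.

Definition crit (k : int) : R := k%:~R / 2 + 4^-1.

Lemma norm_cos_crit k v : `|cos (2 * pi * (crit k + v))| = `|sin (2 * pi * v)|.
Proof.
have h (n : nat) y : `|cos (y + n%:R * pi)| = `|cos y|.
  by rewrite mulr_natl (alternatingn (@cosDpi R)) normrM normrX normrN1 expr1n mul1r.
have hz (m : int) y : `|cos (y + m%:~R * pi)| = `|cos y|.
  case: m => n; first exact: h.
  by rewrite -[LHS](h n.+1) NegzE mulrNz mulNr subrK.
have -> : 2 * pi * (crit k + v) = 2 * pi * v + pi / 2 + k%:~R * pi.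
  by rewrite /crit; field.
by rewrite hz cosDpihalf normrN.
Qed.

Lemma sin_norm v : `|v| <= 4^-1 -> `|sin (2 * pi * v)| = sin (2 * pi * `|v|).
Proof.
move=> v4; have p0 := @pi_gt0 R.
have s0 : 0 <= sin (2 * pi * `|v|).
  by apply: sin_ge0_pi; apply/andP; split; [rewrite !mulr_ge0// ltW|nra].
move: s0; case: (ger0P v) => v0 s0; first by rewrite ger0_norm.
by rewrite -normrN -sinN -mulrN ger0_norm.
Qed.

Lemma norm_cos_ge k u : `|u - crit k| <= 4^-1 -> 4 * `|u - crit k| <= `|cos (2 * pi * u)|.
Proof.
move=> h; rewrite -{2}(subrK (crit k) u) [_ + crit k]addrC norm_cos_crit sin_norm//.
by apply: sin_ge_chord; rewrite normr_ge0.
Qed.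

Lemma exists_crit u : exists k, `|u - crit k| <= 4^-1.
Proof.
exists (Num.floor (2 * u)); rewrite /crit ler_distl.
by have := @floor_le R (2 * u); have := floorD1_gt (2 * u); rewrite intrD; lra.
Qed.

(** Some critical point is within [1/4] of [u]. Measured from it the cosine is a sine up to sign,
    and [sin (2 pi x)] increases on [[0, 1/4]]. *)
Lemma norm_cos_ge_sin u d : 0 <= d -> (forall k, d <= `|u - crit k|) ->
  sin (2 * pi * d) <= `|cos (2 * pi * u)|.
Proof.
move=> d0 hd; have [k hk] := exists_crit u; have dk := hd k.
rewrite -{1}(subrK (crit k) u) [_ + crit k]addrC norm_cos_crit sin_norm//.
have p0 := @pi_gt0 R.
have le2 x : 0 <= x -> x <= 4^-1 -> (2 * pi * x) \in `[(- (pi / 2)), (pi / 2)].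
  by move=> x0 x4; rewrite in_itv/=; apply/andP; split; nra.
have := dk; rewrite le_eqVlt => /predU1P[<-//|lt].
by rewrite ltW// ltr_sin ?le2// ?(le_trans dk)// ltr_pM2l// mulr_gt0.
Qed.

End trigonometric_bounds.

(** * Averaging one step over the noise *)

Section one_step.
Context {R : realType} (s : {posnum R}).
Variables (P : probability (noise_seq s) R) (PP : is_product_measure P).
Local Notation mu := (@lebesgue_measure R).

Lemma noise_lt : - s%:num < s%:num :> R.
Proof. by rewrite gtrN. Qed.

Lemma uniform_prob_noise (A : set (measurableTypeR R)) : measurable A ->
  uniform_prob noise_lt A = noise_leb s A.
Proof.
move=> mA; rewrite /uniform_prob integral_uniform_pdf.
rewrite (eq_integral (fun=> ((2 * s%:num)^-1)%:E)); last first.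
  move=> x; rewrite inE/= in_itv/= => -[_ xs].
  by rewrite /uniform_pdf xs opprK mulr_natl mulr2n.
rewrite integral_cst//; last exact: measurableI.
Qed.

(** The law of the first coordinate is uniform on [[-s, s]]: this is the product formula for
    cylinders of length one. *)
Lemma integral_noise_coord0 (F : R -> \bar R) :
  measurable_fun setT F -> (forall x, 0 <= F x)%E ->
  (\int[P]_w F (noise_coord 0 w) =
   ((2 * s%:num)^-1)%:E * \int[mu]_(t in `[(- s%:num)%R, s%:num]) F t)%E.
Proof.
move=> mF F0.
have -> : (2 * s%:num)^-1 = (s%:num - - s%:num)^-1 by rewrite opprK mulr_natl mulr2n.
rewrite -(integral_uniform noise_lt)//.
rewrite (@eq_measure_integral _ _ _ setT (measure_function_pushforward__canonical__measure_function_Measure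
  P (measurable_noise_coord (s:=s) 0)) (uniform_prob noise_lt)); last first.
  move=> A mA _; transitivity (noise_leb s A); first exact: uniform_prob_noise.
  have := PP 1%N (fun _ => mA); rewrite big_ord1 => <-; congr (P _).
  apply/seteqP; split => w /=; first by move=> /(_ 0%N); apply.
  by move=> ? i; rewrite ltnS leqn0 => /eqP ->.
by rewrite ge0_integral_pushforward//; exact: measurable_noise_coord.
Qed.

Variables (L : R) (L9 : 9 <= L) (s12 : s%:num <= 1 / 2).

Lemma measurable_dstep x : measurable_fun [set: R] (dstep L x).
Proof.
apply: continuous_measurable_fun => t.
have := continuous_cos; rewrite /dstep => cc.
apply: cvgM; first exact: cvg_cst.
apply: (@continuous_comp _ _ _ (fun t => 2 * pi * (x + t)) cos); last exact: continuous_cos.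
apply: cvgM; first exact: cvg_cst.
by apply: cvgD; [exact: cvg_cst|exact: cvg_id].
Qed.

Let L0 : 0 < L. Proof. exact: lt_le_trans L9. Qed.

(* A window of length at most [1] meets at most three of the cells [[k/2, (k+1)/2[],
   each containing one critical point. *)
Lemma invsqrt_dstep_le (x t : R) : - s%:num <= t <= s%:num ->
  let k := Num.floor (2 * (x - s%:num)) in
  (invsqrt (dstep L x t) <= (
   \sum_(j < 3) ((Num.sqrt (8 * pi * L))^-1)%:E * invsqrt (t - (crit (k + j%:Z) - x)))%E)%E.
Proof.
move=> /andP[ts1 ts2]; set k := Num.floor _ => /=.
have p0 := @pi_gt0 R.
have c0 : 0 < 8 * pi * L by rewrite !mulr_gt0.
have k1 : k%:~R <= 2 * (x - s%:num) by exact: floor_le.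
have k2 : 2 * (x - s%:num) < k%:~R + 1 by have := floorD1_gt (2 * (x - s%:num)); rewrite intrD.
have [j hj] : exists j : 'I_3, `|x + t - crit (k + j%:Z)| <= 4^-1.
  have cE (j : nat) : crit (k + j%:Z) = k%:~R / 2 + j%:R / 2 + 4^-1 :> R.
    by rewrite /crit intrD (_ : j%:Z%:~R = j%:R :> R)// mulrDl.
  have [h|h] := ltP (2 * (x + t)) (k%:~R + 1).
    by exists (inord 0); rewrite inordK// cE ler_distl; apply/andP; split; lra.
  have [h'|h'] := ltP (2 * (x + t)) (k%:~R + 2).
    by exists (inord 1); rewrite inordK// cE ler_distl; apply/andP; split; lra.
  by have s12' := s12; exists (inord 2); rewrite inordK// cE ler_distl; apply/andP; split; lra.
apply: (@le_trans _ _ (((Num.sqrt (8 * pi * L))^-1)%:E * invsqrt (t - (crit (k + j%:Z) - x)))%E); last first.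
  rewrite (bigD1 j)//= leeDl// sume_ge0// => i _.
  by rewrite mule_ge0 ?invsqrt_ge0// lee_fin invr_ge0 sqrtr_ge0.
have -> : ((Num.sqrt (8 * pi * L))^-1)%:E = invsqrt (8 * pi * L).
  by rewrite /invsqrt gt_eqF// gtr0_norm.
rewrite -invsqrtM; apply: invsqrt_le.
have -> : t - (crit (k + j%:Z) - x) = x + t - crit (k + j%:Z) by ring.
rewrite /dstep !normrM; have := norm_cos_ge hj.
have -> : `|2| = 2 :> R by rewrite ger0_norm.
have -> : `|8| = 8 :> R by rewrite ger0_norm.
rewrite (gtr0_norm p0) (gtr0_norm L0) => h.
have -> : 8 * pi * L * `|x + t - crit (k + j%:Z)| = 2 * pi * L * (4 * `|x + t - crit (k + j%:Z)|).
  by ring.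
by rewrite ler_pM2l// !mulr_gt0.
Qed.

(** Each of the three critical points contributes at most [4 * Num.sqrt s] to the integral. Division
    by [2 * s] turns the factor [12] into [6] and leaves [Num.sqrt s] in the denominator; nothing
    depends on [x]. *)
Lemma integral_invsqrt_dstep x :
  (\int[P]_w invsqrt (dstep L x (noise_coord 0 w)) <=
   (6 / Num.sqrt (8 * pi * L * s%:num))%:E)%E.
Proof.
have mi : measurable_fun [set: measurableTypeR R] (fun t => invsqrt (dstep L x t)).
  exact: (measurableT_comp measurable_invsqrt (measurable_dstep x)).
rewrite (integral_noise_coord0 mi); last by move=> ?; exact: invsqrt_ge0.
have p0 := @pi_gt0 R.
have c0 : 0 < 8 * pi * L by rewrite !mulr_gt0.
have s0 : 0 < s%:num :> R by [].
pose k := Num.floor (2 * (x - s%:num)).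
set c := (Num.sqrt (8 * pi * L))^-1.
have c_ge0 : 0 <= c by rewrite invr_ge0 sqrtr_ge0.
have mj j : measurable_fun [set: measurableTypeR R]
   (fun t => (c%:E * invsqrt (t - (crit (k + j%:Z) - x)))%E).
  by apply: measurable_funeM; exact: measurable_invsqrtB.
apply: (@le_trans _ _ (((2 * s%:num)^-1)%:E * (\sum_(j < 3) (c * (4 * Num.sqrt s%:num))%:E))%E).
  apply: lee_wpmul2l; first by rewrite lee_fin invr_ge0 mulr_ge0.
  apply: (@le_trans _ _ (\int[mu]_(t in `[(- s%:num)%R, s%:num])
      \sum_(j < 3) (c%:E * invsqrt (t - (crit (k + j%:Z) - x))))%E).
    apply: ge0_le_integral => //.
    - by move=> ? _; exact: invsqrt_ge0.
    - exact: measurable_funTS.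
    - apply: measurable_funTS; apply: emeasurable_sum => j; exact: mj.
    - by move=> t; rewrite /= in_itv/=; exact: invsqrt_dstep_le.
  rewrite ge0_integral_sum//; last 2 first.
  - by move=> j; apply: measurable_funTS; exact: mj.
  - by move=> j t _; rewrite mule_ge0 ?invsqrt_ge0 ?lee_fin.
  apply: lee_sum => j _.
  rewrite ge0_integralZl_EFin//; last 2 first.
  - by move=> t _; exact: invsqrt_ge0.
  - by apply: measurable_funTS; exact: measurable_invsqrtB.
  by rewrite EFinM lee_wpmul2l ?lee_fin//; exact: integral_invsqrt.
rewrite sumEFin -EFinM lee_fin sumr_const card_ord /c.
rewrite [in leRHS]sqrtrM ?(ltW c0)// -mulr_natl le_eqVlt; apply/orP; left; apply/eqP.
have ss : s%:num = Num.sqrt s%:num * Num.sqrt s%:num by rewrite -expr2 sqr_sqrtr.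
rewrite {1}ss; field.
by rewrite !gt_eqF ?sqrtr_gt0.
Qed.

End one_step.

(** * Lyapunov exponents *)

Section circle_measurability.
Context {R : realType}.

Lemma measurable_circle_continuous (f : circle R -> R) : continuous f ->
  measurable_fun setT f.
Proof.
move=> cf mD; apply: (measurability _ (RGenOInfty.measurableE R)) => //.
move=> _ [_ [x ->] <-]; rewrite setTI; apply: sub_sigma_algebra.
by move/continuousP : cf; apply; exact: interval_open.
Qed.

Lemma measurable_comp_repr (g : R -> R) : continuous g ->
  (forall x (k : int), g (x + k%:~R) = g x) ->
  measurable_fun setT (fun z : circle R => g (repr z)).
Proof.
move=> cg gk; apply: measurable_circle_continuous.
apply/(@quotient_continuous R {eq_quot (@eqmodZ_equiv R)}%qT).
rewrite (_ : _ \o _ = g)//; apply/funext => x /=.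
by have [k /= ->] := repr_circle_proj x.
Qed.

Lemma continuous_cos2pi : continuous (fun x : R => cos (2 * pi * x)).
Proof.
move=> x; apply: (@continuous_comp _ _ _ (fun t => 2 * pi * t) cos); last exact: continuous_cos.
by apply: cvgM; [exact: cvg_cst|exact: cvg_id].
Qed.

Lemma continuous_sin2pi : continuous (fun x : R => sin (2 * pi * x)).
Proof.
move=> x; apply: (@continuous_comp _ _ _ (fun t => 2 * pi * t) sin); last exact: continuous_sin.
by apply: cvgM; [exact: cvg_cst|exact: cvg_id].
Qed.

(* [repr] need not be measurable: only its composites with continuous 1-periodic
   functions are. *)
Lemma measurable_dclift (L a : R) d (T : measurableType d) (t : T -> nat -> R) (x : T -> R) n :
  (forall i, measurable_fun setT (fun u => t u i)) ->
  measurable_fun setT (fun u => cos (2 * pi * x u)) ->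
  measurable_fun setT (fun u => sin (2 * pi * x u)) ->
  measurable_fun setT (fun u => dclift L a (t u) n (x u)).
Proof.
move=> mt mc ms.
have mcos := continuous_measurable_fun continuous_cos2pi.
have msin := continuous_measurable_fun continuous_sin2pi.
have mct i : measurable_fun setT (fun u => cos (2 * pi * t u i)) by exact: (measurableT_comp mcos).
have mst i : measurable_fun setT (fun u => sin (2 * pi * t u i)) by exact: (measurableT_comp msin).
(* The induction carries the cosine and sine of the lift, not the lift, which at time [0] is [x u]
   itself. The addition formulas separate the lift from the noise. *)
suff [_ _ //] : [/\ measurable_fun setT (fun u => cos (2 * pi * clift L a (t u) n (x u))),
  measurable_fun setT (fun u => sin (2 * pi * clift L a (t u) n (x u))) &
  measurable_fun setT (fun u => dclift L a (t u) n (x u))].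
elim: n => [|n [mcn msn mdn]] /=; first by split.
have msum : measurable_fun setT (fun u => sin (2 * pi * (clift L a (t u) n (x u) + t u n))).
  under eq_fun do rewrite mulrDr sinD.
  by apply: measurable_funD; apply: measurable_funM.
have mcum : measurable_fun setT (fun u => cos (2 * pi * (clift L a (t u) n (x u) + t u n))).
  under eq_fun do rewrite mulrDr cosD.
  by apply: measurable_funB; apply: measurable_funM.
have mlift : measurable_fun setT (fun u => L * sin (2 * pi * (clift L a (t u) n (x u) + t u n)) + a).
  by apply: measurable_funD => //; apply: measurable_funM.
split.
- exact: (measurableT_comp mcos mlift).
- exact: (measurableT_comp msin mlift).
- by apply: measurable_funM => //; rewrite /dstep; apply: measurable_funM.
Qed.

End circle_measurability.

(** * Exponential decay of the moments and the exponent *)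

Section lyapunov_exponent.
Context {R : realType} (s : {posnum R}).
Variables (P : probability (noise_seq s) R) (PP : is_product_measure P).
Variables (a L : R) (L9 : 9 <= L) (s12 : s%:num <= 1 / 2)
  (sL : 11 / 10 * L `^ (- (1 / 2)) <= s%:num).

Let L0 : 0 < L. Proof. exact: lt_le_trans L9. Qed.

Let rho := 6 / Num.sqrt (8 * pi * L * s%:num).
Let q := L `^ (- (1 / 8)).

Let rho_gt0 : 0 < rho.
Proof. by rewrite divr_gt0// sqrtr_gt0 !mulr_gt0// pi_gt0. Qed.

(** With [N = L^(1/4)], after squaring the claim is [36 N < 8 pi L sigma]. The lower bound on
    [sigma] gives [L sigma >= 11/10 N^2], and [L >= 9] gives [N >= 3/2]; with [pi >= 3] the right
    side is at least [39.6 N]. *)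
Lemma rho_lt_q : rho < q.
Proof.
set N := L `^ (1 / 4).
have N0 : 0 < N by exact: powR_gt0.
have NL4 : N ^+ 4 = L.
  by rewrite -powR_mulrn ?ltW// -powRrM [X in L `^ X](_ : _ = 1) ?powRr1 ?(ltW L0)//; field.
have N2E : L `^ (- (1 / 2)) = (N ^+ 2)^-1.
  by rewrite powRN; congr (_^-1); rewrite -powR_mulrn ?ltW// -powRrM; congr (_ `^ _); field.
have q2 : q ^+ 2 = N^-1.
  by rewrite /q -powR_mulrn ?powR_ge0// -powRrM /N -powRN; congr (_ `^ _); field.
have N3 : 3 / 2 <= N.
  rewrite leNgt; apply/negP => Nlt.
  have N2lt : N ^+ 2 < 9 / 4 by rewrite expr2; nra.
  have : N ^+ 4 < 9 by rewrite (_ : N ^+ 4 = N ^+ 2 * N ^+ 2) -?exprD//; have := sqr_ge0 N; nra.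
  by rewrite NL4 => /lt_le_trans /(_ L9); rewrite ltxx.
have Ls : 11 / 10 * N ^+ 2 <= L * s%:num.
  have sL' := sL; rewrite N2E in sL'.
  have h : L * (11 / 10 * (N ^+ 2)^-1) = 11 / 10 * N ^+ 2.
    by rewrite -NL4; field; rewrite gt_eqF.
  by rewrite -h ler_pM2l.
have q_gt0 : 0 < q by exact: powR_gt0.
rewrite -(@ltr_pXn2r _ 2)// ?nnegrE ?(ltW rho_gt0) ?(ltW q_gt0)// q2 /rho.
have p3 := @pi_ge3 R.
have Ls0 : 0 < 8 * pi * L * s%:num by rewrite !mulr_gt0// pi_gt0.
rewrite expr_div_n sqr_sqrtr ?(ltW Ls0)//.
rewrite ltr_pdivrMr// -ltr_pdivrMl ?invr_gt0// invrK.
rewrite -!mulrA.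
have Lsp : 0 < L * s%:num by rewrite mulr_gt0.
have e1 : 3 * (L * s%:num) <= pi * (L * s%:num) by rewrite ler_pM2r.
have e2 : N * (3 / 2) <= N ^+ 2 by rewrite expr2 ler_pM2l.
by rewrite expr2; lra.
Qed.

Lemma clift_splice n (w w' : noise_seq s) x :
  clift L a (fun i => noise_coord i (splice n w w')) n x =
    clift L a (fun i => noise_coord i w) n x /\
  dclift L a (fun i => noise_coord i (splice n w w')) n x =
    dclift L a (fun i => noise_coord i w) n x.
Proof.
suff h m : (m <= n)%N -> clift L a (fun i => noise_coord i (splice n w w')) m x =
    clift L a (fun i => noise_coord i w) m x /\
    dclift L a (fun i => noise_coord i (splice n w w')) m x =
    dclift L a (fun i => noise_coord i w) m x by exact: h.
elim: m => //= m IH mn; have [e1 e2] := IH (ltnW mn).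
by rewrite e1 e2 /splice /noise_coord mn.
Qed.

Lemma integral_invsqrt_dclift n x :
  (\int[P]_w invsqrt (dclift L a (fun i => noise_coord i w) n x) <= (rho ^+ n)%:E)%E.
Proof.
(* Blocks of length one: the new factor is the derivative of the next step, taken at a point that
   the first [n] noises determine. *)
apply: (@integral_prod_le _ _ _ PP 1
  (fun n w => invsqrt (dclift L a (fun i => noise_coord i w) n x))
  (fun n w w' => invsqrt (dstep L (clift L a (fun i => noise_coord i w) n x) (noise_coord 0 w')))) => //.
- by move=> w; exact: invsqrt1.
- move=> m; apply: (measurableT_comp measurable_invsqrt).
  by apply: measurable_dclift => // i; exact: measurable_noise_coord.
- by move=> m w; exact: invsqrt_ge0.
- move=> m w; apply: (measurableT_comp measurable_invsqrt).
  exact: (measurableT_comp (measurable_dstep L _) (measurable_noise_coord (s:=s) 0)).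
- by move=> m w w'; exact: invsqrt_ge0.
- move=> m w w'; rewrite mul1n /=; have [e1 e2] := clift_splice m w w' x.
  by rewrite e1 e2 invsqrtM /splice /noise_coord ltnn subnn.
- by move=> m w; exact: integral_invsqrt_dstep.
Qed.

Lemma measurable_cderiv_iter n :
  measurable_fun setT (fun wz : noise_seq s * circle R =>
    cderiv (circle_iter L a wz.1 n) wz.2).
Proof.
under eq_fun do rewrite cderiv_circle_iter.
apply: measurable_dclift.
- by move=> i; exact: (measurableT_comp (measurable_noise_coord (s:=s) i) measurable_fst).
- exact: (measurableT_comp (measurable_comp_repr continuous_cos2pi cos_int) measurable_snd).
- exact: (measurableT_comp (measurable_comp_repr continuous_sin2pi sin_int) measurable_snd).
Qed.

(** Tonelli, integrating over the noise first: the bound is uniform in the starting point, and the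
    circle has mass one. *)
Lemma integral_invsqrt_cderiv n :
  (\int[P \x circle_leb]_wz invsqrt (cderiv (circle_iter L a wz.1 n) wz.2) <= (rho ^+ n)%:E)%E.
Proof.
have mU : measurable_fun setT (fun wz : noise_seq s * circle R =>
    invsqrt (cderiv (circle_iter L a wz.1 n) wz.2)).
  exact: (measurableT_comp measurable_invsqrt (measurable_cderiv_iter n)).
rewrite fubini_tonelli1//; last by move=> ?; exact: invsqrt_ge0.
rewrite fubini_tonelli//; last by move=> ?; exact: invsqrt_ge0.
have -> : (rho ^+ n)%:E = (\int[circle_leb]_(z in [set: circle R]) (rho ^+ n)%:E)%E.
  by rewrite integral_cst//= probability_setT mule1.
apply: ge0_le_integral => //.
- by move=> z _; apply: integral_ge0 => w _; exact: invsqrt_ge0.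
- apply: (measurable_fun_fubini_tonelli_G _ mU).
  by move=> ?; exact: invsqrt_ge0.
- move=> z _; apply: le_trans (integral_invsqrt_dclift n (repr z)).
  by under eq_integral do rewrite /= cderiv_circle_iter.
Qed.

Lemma limn_einf_ge (u : nat -> \bar R) (c : \bar R) n0 :
  (forall n, (n0 <= n)%N -> (c <= u n)%E) -> (c <= limn_einf u)%E.
Proof.
move=> cu; rewrite limn_einf_lim; apply: lime_ge; first exact: is_cvg_einfs.
exists n0 => // n /= n0n; apply: le_ereal_inf_tmp => _ /= [m nm <-].
by apply: cu; exact: leq_trans nm.
Qed.

(** The hypothesis reads [|D|^(-1/2) <= L^(-n/8)], that is [|D| >= L^(n/4)]; it excludes [D = 0],
    where [invsqrt] is [+oo]. *)
Lemma ln_norm_ge (D : R) n : (invsqrt D <= (q ^+ n)%:E)%E ->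
  0 < `|D| /\ n%:R / 4 * ln L <= ln `|D|.
Proof.
rewrite /invsqrt; case: (eqVneq D 0) => [_|D0]; first by rewrite leye_eq.
rewrite lee_fin => h.
have D0' : 0 < `|D| by rewrite normr_gt0.
split => //.
have q0 : 0 < q by exact: powR_gt0.
have : ln (Num.sqrt `|D|)^-1 <= ln (q ^+ n).
  by rewrite ler_ln// posrE ?exprn_gt0// invr_gt0 sqrtr_gt0.
rewrite lnV ?posrE ?sqrtr_gt0// -powR12_sqrt// ln_powR.
rewrite -powR_mulrn ?powR_ge0// -powRrM ln_powR; lra.
Qed.

Lemma lyapunov_exponent_gt :
  {ae (P \x circle_leb)%E, forall wx : noise_seq s * circle R,
     ((1 / 8 * ln L)%:E <
      limn_einf (fun n : nat =>
        (n%:R^-1)%:E * lne `|cderiv (circle_iter L a wx.1 n) wx.2|%:E))%E}.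
Proof.
have := @ae_eventually_le _ _ R (P \x circle_leb)%E
  (fun n wx => invsqrt (cderiv (circle_iter L a wx.1 n) wx.2)) rho q rho_gt0 rho_lt_q
  (fun n => measurableT_comp measurable_invsqrt (measurable_cderiv_iter n))
  (fun n w => invsqrt_ge0 _) integral_invsqrt_cderiv.
apply: filterS => wx [n0 hn0].
have lnL : 0 < ln L by apply: ln_gt0; have := L9; lra.
(* The moments give the rate [1/4] as a weak bound; halving it makes the inequality strict. *)
apply: (@lt_le_trans _ _ (1 / 4 * ln L)%:E); first by rewrite lte_fin; lra.
apply: (@limn_einf_ge _ _ (maxn n0 1)) => n; rewrite geq_max => /andP[n0n n1].
have [D0 hD] := ln_norm_ge (hn0 n n0n).
rewrite lne_EFin// -EFinM lee_fin.
have n_gt0 : 0 < n%:R :> R by rewrite ltr0n.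
rewrite mulrC ler_pdivlMl//; apply: le_trans hD.
by rewrite le_eqVlt; apply/orP; left; apply/eqP; field.
Qed.

End lyapunov_exponent.

(** * Covering the circle *)

Section covering.
Context {R : realType}.
Variables (a L : R) (L9 : 9 <= L).
Implicit Types (t : nat -> R) (x y u c r : R) (A : set R).

Definition step x s : R := L * sin (2 * pi * (x + s)) + a.

Let L0 : 0 < L. Proof. by have := L9; lra. Qed.
Let p0 : 0 < pi :> R. Proof. exact: pi_gt0. Qed.

(** The growth phase, on the line: the image of [A] contains an arc of half-length [r], reached
    without loss of derivative. *)
Definition expands t n A c r := forall y, `|y - c| <= r ->
  exists x, [/\ A x, clift L a t n x = y & 1 <= `|dclift L a t n x| ].

(** The phase after wrapping around the circle; the threshold [2] is the constant [kappa] of the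
    horseshoes. *)
Definition covers t n A := forall y,
  exists x, [/\ A x, clift L a t n x - y \is a Num.int & 2 < `|dclift L a t n x| ].

Lemma continuous_step s : continuous (fun x => step x s).
Proof.
move=> x; apply: differentiable_continuous; apply/derivable1_diffP.
by case: (is_derive_step L a s x).
Qed.

Lemma continuous_dstep s : continuous (fun x => dstep L x s).
Proof.
move=> x; rewrite /dstep; apply: cvgM; first exact: cvg_cst.
apply: (@continuous_comp _ _ _ (fun x => x + s) (fun y => cos (2 * pi * y))).
  by apply: cvgD; [exact: cvg_id|exact: cvg_cst].
exact: continuous_cos2pi.
Qed.

Lemma step_int x s (k : int) : step (x + k%:~R) s = step x s.
Proof. by rewrite /step addrAC sin_int. Qed.

Lemma dstep_int x s (k : int) : dstep L (x + k%:~R) s = dstep L x s.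
Proof. by rewrite /dstep addrAC cos_int. Qed.

(** The derivative does not vanish on the arc, so it keeps its sign. By the mean value theorem the
    two end points are sent to opposite sides of [step c s], each at distance at least [lam * r],
    and the intermediate value theorem fills the gap. *)
Lemma step_onto s c r lam y : 0 < r -> 0 < lam ->
  (forall u, `|u - c| <= r -> lam <= `|dstep L u s|) ->
  `|y - step c s| <= lam * r ->
  exists2 u, `|u - c| <= r & step u s = y.
Proof.
move=> r0 lam0 hlam hy.
have [v1 + h1] := @MVT R (step^~ s) (fun x => dstep L x s) c (c + r) ltac:(lra)
  (fun x _ => is_derive_step L a s x) (continuous_subspaceT (@continuous_step s)).
have [v2 + h2] := @MVT R (step^~ s) (fun x => dstep L x s) (c - r) c ltac:(lra)
  (fun x _ => is_derive_step L a s x) (continuous_subspaceT (@continuous_step s)).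
rewrite !in_itv/= => /andP[v2l v2r] /andP[v1l v1r].
have e1 : lam <= `|dstep L v1 s| by apply: hlam; rewrite ler_distl; apply/andP; split; lra.
have e2 : lam <= `|dstep L v2 s| by apply: hlam; rewrite ler_distl; apply/andP; split; lra.
have sgn : 0 < dstep L v1 s * dstep L v2 s.
  rewrite ltNge; apply/negP => neg.
  have v21 : v2 <= v1 by lra.
  (* Opposite signs at [v1] and [v2] would force a zero of the derivative between them, against the
     lower bound [lam]. *)
  have [||v + v0] := @IVT R (fun x => dstep L x s) v2 v1 0 v21.
  - exact: (continuous_subspaceT (@continuous_dstep s)).
  - rewrite ge_min le_max.
    have [d1|d1] := leP (dstep L v1 s) 0; have [d2|d2] := leP (dstep L v2 s) 0 => /=.
    + rewrite (ler0_norm d1) in e1; rewrite (ler0_norm d2) in e2; nra.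
    + by rewrite (ltW d2).
    + by rewrite (ltW d1) orbT.
    + by rewrite ltNge in d1; rewrite ltNge in d2; nra.
  - rewrite in_itv/= => /andP[l1 l2].
    have : lam <= `|dstep L v s| by apply: hlam; rewrite ler_distl; apply/andP; split; lra.
    by rewrite v0 normr0; lra.
have hl : c - r <= c + r by lra.
have [||v + vy] := @IVT R (step^~ s) (c - r) (c + r) y hl.
- exact: (continuous_subspaceT (@continuous_step s)).
- rewrite ge_min le_max; move: hy; rewrite ler_distl => /andP[y1 y2].
  have er : c + r - c = r by ring.
  have er' : c - (c - r) = r by ring.
  rewrite er in h1; rewrite er' in h2.
  case: (ltP 0 (dstep L v1 s)) => d1.
    have d2 : 0 < dstep L v2 s by rewrite pmulr_rgt0 in sgn.
    rewrite (gtr0_norm d1) in e1; rewrite (gtr0_norm d2) in e2.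
    have i1 : lam * r <= dstep L v1 s * r by rewrite ler_pM2r.
    have i2 : lam * r <= dstep L v2 s * r by rewrite ler_pM2r.
    by apply/andP; split; apply/orP; [left|right]; lra.
  have d2 : dstep L v2 s < 0 by nra.
  rewrite (ler0_norm d1) in e1; rewrite (ltr0_norm d2) in e2.
  have i1 : lam * r <= - dstep L v1 s * r by rewrite ler_pM2r.
  have i2 : lam * r <= - dstep L v2 s * r by rewrite ler_pM2r.
  by apply/andP; split; apply/orP; [right|left]; lra.
- rewrite in_itv/= => /andP[l1 l2]; exists v => //.
  by rewrite ler_distl; apply/andP; split; lra.
Qed.

Lemma expands_step t n A c r lam y : 0 < r -> 1 <= lam ->
  (forall u, `|u - c| <= r -> lam <= `|dstep L u (t n)|) ->
  expands t n A c r -> `|y - step c (t n)| <= lam * r ->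
  exists x, [/\ A x, clift L a t n.+1 x = y & lam <= `|dclift L a t n.+1 x| ].
Proof.
move=> r0 lam1 hlam hexp hy.
have [u uc uy] := step_onto r0 (lt_le_trans ltr01 lam1) hlam hy.
have [x [Ax xu dx]] := hexp u uc.
exists x; split => //=; first by rewrite xu.
rewrite xu normrM; apply: le_trans (hlam _ uc) _.
by rewrite ler_peMl.
Qed.

(** Take the representative [y'] of [y] in [[a, a + 1[] and solve [sin = (y' - a) / L]. This value
    is at most [1/2], so the cosine is at least [1/2] and the derivative at least [pi L]. *)
Lemma step_onto_circle y s : exists u, step u s - y \is a Num.int /\ 1 <= `|dstep L u s|.
Proof.
pose y' := y - (Num.floor (y - a))%:~R.
have y'1 : 0 <= y' - a < 1.
  have := @floor_le R (y - a); have := floorD1_gt (y - a); rewrite intrD /y'.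
  by move=> h1 h2; apply/andP; split; lra.
move: y'1 => /andP[ya0 ya1].
pose b := (y' - a) / L.
have b0 : 0 <= b by rewrite divr_ge0// ltW.
have b1 : b <= 1 / 2 by rewrite /b ler_pdivrMr//; have := L9; lra.
have b11 : b \in `[(-1), 1] by rewrite in_itv/=; apply/andP; split; lra.
exists (asin b / (2 * pi) - s).
have e : 2 * pi * (asin b / (2 * pi) - s + s) = asin b.
  by rewrite subrK mulrCA divff ?mulr1// mulf_neq0// gt_eqF.
split.
  rewrite /step e asinK// /b mulrCA divff ?gt_eqF// mulr1 subrK /y'.
  by rewrite addrAC subrr sub0r rpredN intr_int.
rewrite /dstep e cos_asin; last by move: b11; rewrite in_itv.
have sq : 2^-1 <= Num.sqrt (1 - b ^+ 2).
  rewrite -(@ler_pXn2r _ 2)// ?nnegrE ?sqrtr_ge0// sqr_sqrtr; [nra|].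
  by nra.
rewrite ger0_norm ?mulr_ge0 ?sqrtr_ge0 ?ltW//.
have p3 := @pi_ge3 R; have L9' := L9.
have pl : 1 * 2 <= 2 * pi * L by nra.
nra.
Qed.

(** Whatever the next noise, every point has a preimage where the derivative is at least [1], so a
    covering persists and return times may be arbitrarily long. *)
Lemma coversS t n A : covers t n A -> covers t n.+1 A.
Proof.
move=> cov y; have [u [uy du]] := step_onto_circle y (t n).
have [x [Ax /intrP[k hk] dx]] := cov u.
have xu : clift L a t n x = u + k%:~R by rewrite -hk addrC subrK.
exists x; split => //=.
  by rewrite xu -/(step _ _) step_int.
rewrite xu dstep_int normrM; apply: lt_le_trans dx _.
by rewrite ler_peMr.
Qed.

Lemma covers_le t n m A : (n <= m)%N -> covers t n A -> covers t m A.
Proof.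
move=> /subnK <- cov; elim: (m - n)%N => // k IH.
by rewrite addSn; exact: coversS.
Qed.

Let M : R := Num.sqrt L.
Let M2 : M * M = L. Proof. by rewrite -expr2 sqr_sqrtr// ltW. Qed.
Let M3 : 3 <= M.
Proof.
have M_ge0 : 0 <= M by exact: sqrtr_ge0.
rewrite leNgt; apply/negP => Mlt; have := L9; rewrite -M2; nra.
Qed.

(** If both points are near the same critical point, then [|s1 - s2| < 2 D]. Otherwise two critical
    points, at least [1/2] apart, would be at distance less than [4 D + 2 D <= 1/2]. *)
Lemma near_crit_apart D c s1 s2 : D <= 12%:R^-1 ->
  2 * D <= `|s1 - s2| -> `|s1 - s2| <= 4 * D ->
  (exists k, `|c + s1 - crit k| < D) -> (exists k, `|c + s2 - crit k| < D) -> False.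
Proof.
move=> D12 ge2 le4 [k1 hk1] [k2 hk2].
have [k12|k12] := eqVneq k1 k2.
  have : `|s1 - s2| < D + D.
    have -> : s1 - s2 = (c + s1 - crit k1) - (c + s2 - crit k2) by rewrite k12; ring.
    by apply: le_lt_trans (ler_normB _ _) _; exact: ltrD.
  by lra.
have : 1 <= `|(k1 - k2)%:~R| :> R.
  by rewrite -intr_norm ler1z -gtz0_ge1 normr_gt0 subr_eq0.
have -> : (k1 - k2)%:~R = 2 * ((s1 - s2) - ((c + s1 - crit k1) - (c + s2 - crit k2))) :> R.
  by rewrite /crit rmorphB /=; field.
rewrite normrM ger0_norm// => h.
have h1 := ler_normB (s1 - s2) (c + s1 - crit k1 - (c + s2 - crit k2)).
have h2 := ler_normB (c + s1 - crit k1) (c + s2 - crit k2).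
lra.
Qed.

(* Pigeonhole: each of the two points [c0 + s], [c1 + s] is close to a critical point for
   at most one of the three values [-2D, 0, 2D] of the noise [s]. *)
Lemma exists_far_from_crit D c0 c1 : 0 < D -> D <= 12%:R^-1 ->
  exists s, [/\ `|s| <= 2 * D, forall k, D <= `|c0 + s - crit k| &
                forall k, D <= `|c1 + s - crit k| ].
Proof.
move=> D0 D12.
pose bad c s := exists k, `|c + s - crit k| < D.
have nbad c s : ~ bad c s -> forall k, D <= `|c + s - crit k|.
  by move=> nb k; rewrite leNgt; apply/negP => h; apply: nb; exists k.
have ap c s1 s2 := @near_crit_apart D c s1 s2 D12.
have n2 : `|2 * D| = 2 * D by rewrite ger0_norm// mulr_ge0// ltW.
have n4 : `|4 * D| = 4 * D by rewrite ger0_norm// mulr_ge0// ltW.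
have a1 c : bad c 0 -> bad c (2 * D) -> False.
  by apply: ap; rewrite sub0r normrN n2; lra.
have a2 c : bad c 0 -> bad c (- (2 * D)) -> False.
  by apply: ap; rewrite sub0r opprK n2; lra.
have a3 c : bad c (2 * D) -> bad c (- (2 * D)) -> False.
  by apply: ap; rewrite opprK (_ : 2 * D + 2 * D = 4 * D) ?n4; lra.
have key s : `|s| <= 2 * D -> ~ bad c0 s -> ~ bad c1 s ->
    exists s, [/\ `|s| <= 2 * D, forall k, D <= `|c0 + s - crit k| &
                forall k, D <= `|c1 + s - crit k| ].
  by move=> h b0 b1; exists s; split => //; exact: nbad.
have [z0|z0] := pselect (bad c0 0); have [z1|z1] := pselect (bad c1 0).
- by apply: (key (2 * D)); [rewrite n2|move/(a1 _ z0)|move/(a1 _ z1)].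
- have [y1|y1] := pselect (bad c1 (2 * D)).
    by apply: (key (- (2 * D))); [rewrite normrN n2|move/(a2 _ z0)|move/(a3 _ y1)].
  by apply: (key (2 * D)); [rewrite n2|move/(a1 _ z0)|].
- have [y1|y1] := pselect (bad c0 (2 * D)).
    by apply: (key (- (2 * D))); [rewrite normrN n2|move/(a3 _ y1)|move/(a2 _ z1)].
  by apply: (key (2 * D)); [rewrite n2| |move/(a1 _ z1)].
- by apply: (key 0); [rewrite normr0 mulr_ge0// ltW| |].
Qed.

(** All scales are multiples of [1 / M = L^(-1/2)]. A centre at distance [1/4] from the critical
    points, an arc of half-length [1/8] and a noise error of [1/200] leave the distance
    [3/25 = 1/4 - 1/8 - 1/200], where the derivative is at least [lam]. *)
Let r1 : R := 8^-1 / M.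
Let d1 : R := 3 / 25 / M.
Let lam : R := 2 * pi * L * sin (2 * pi * d1).

Let MV : 0 < M^-1. Proof. by rewrite invr_gt0; have := M3; lra. Qed.
Let MV3 : M^-1 <= 3^-1. Proof. by rewrite lef_pV2 ?posrE; have := M3; lra. Qed.
Let r1_gt0 : 0 < r1. Proof. by rewrite /r1; have := MV; lra. Qed.
Let d1_gt0 : 0 < d1. Proof. by rewrite /d1; have := MV; lra. Qed.

(* As [2 * (lam * r1) > 1], an arc of half-length [r1] at distance [d1] from the critical
   points is mapped onto the whole circle. *)
Lemma lam_r1_gt : 13 / 25 <= lam * r1.
Proof.
have p3 := @pi_ge3 R.
have p4 : pi < 4 :> R by have := @pihalf_lt2 R; lra.
have MV3' := MV3; have MV' := MV.
pose y := 2 * pi * d1.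
have yE : y = 6 / 25 * pi * M^-1 by rewrite /y /d1; field; rewrite gt_eqF// -invr_gt0.
have y0 : 0 <= y by rewrite yE; apply: mulr_ge0; lra.
have yp : y <= 2 / 25 * pi.
  rewrite yE; have : pi * M^-1 <= pi * 3^-1 by rewrite ler_pM2l.
  by lra.
have sy : y * (1 - y ^+ 2 / 2) <= sin y by apply: sin_ge_near0; apply/andP; split; lra.
have Mn0 : M != 0 by rewrite gt_eqF// -invr_gt0.
have MM : M * M^-1 = 1 by rewrite divff.
have lamE : lam * r1 = pi / 4 * M * sin y.
  rewrite /lam /r1 -M2 -/y.
  transitivity (pi / 4 * M * sin y * (M * M^-1)); first by field; exact: Mn0.
  by rewrite MM mulr1.
have c0 : 0 <= pi / 4 * M by apply: mulr_ge0; have := M3; lra.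
have : pi / 4 * M * (y * (1 - y ^+ 2 / 2)) <= lam * r1 by rewrite lamE ler_wpM2l.
apply: le_trans.
have -> : pi / 4 * M * (y * (1 - y ^+ 2 / 2)) = 3 / 50 * (pi * pi) * (1 - y ^+ 2 / 2).
  set Y := 1 - y ^+ 2 / 2; rewrite yE.
  transitivity (3 / 50 * (pi * pi) * (M * M^-1) * Y); first by field; exact: Mn0.
  by rewrite MM mulr1.
have y2 : y ^+ 2 <= 4 / 625 * (pi * pi).
  have -> : 4 / 625 * (pi * pi) = (2 / 25 * pi) ^+ 2 :> R by field.
  by rewrite ler_pXn2r// nnegrE//; lra.
(* It remains to bound [3/50 p (1 - 2/625 p)] for [p = pi * pi] in [[9, 16]]; it is concave in [p],
   with minimum about [0.524] at [p = 9]. *)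
have P9 : 9 <= pi * pi :> R by nra.
have P16 : pi * pi <= 16 :> R by nra.
nra.
Qed.

Lemma lam_gt12 : 12 <= lam.
Proof.
have h := lam_r1_gt.
have r1le : r1 <= 24^-1 by rewrite /r1; have := MV3; lra.
rewrite leNgt; apply/negP => l12; have := r1_gt0; nra.
Qed.

Lemma dstep_ge s0 s c u : (forall k, 4^-1 / M <= `|c + s0 - crit k|) ->
  `|s - s0| <= 200^-1 / M -> `|u - c| <= r1 -> lam <= `|dstep L u s|.
Proof.
move=> hc hs hu; have pl : 0 < 2 * pi * L by rewrite !mulr_gt0.
rewrite /dstep normrM gtr0_norm// /lam ler_pM2l//.
apply: norm_cos_ge_sin; first exact: ltW d1_gt0.
move=> k; have := hc k.
have -> : c + s0 - crit k = (u + s - crit k) - (u - c) - (s - s0) by ring.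
move=> h; have h1 := ler_normB (u + s - crit k - (u - c)) (s - s0).
have h2 := ler_normB (u + s - crit k) (u - c).
have MV' := MV.
by rewrite /d1; rewrite /r1 in hu; lra.
Qed.

Lemma norm_sinB x y : `|sin x - sin y| <= `|x - y|.
Proof.
wlog xy : x y / x <= y.
  move=> h; case: (leP x y) => [|/ltW] /h //.
  by rewrite distrC [in leRHS]distrC.
have [c _ e] := @MVT_segment R sin cos x y xy (fun x _ => is_derive_sin x)
  (continuous_subspaceT (@continuous_sin R)).
rewrite distrC e normrM [in leRHS]distrC ler_piMl// ler_norml.
by rewrite cos_geN1 cos_le1.
Qed.

Lemma step_lipschitz c s1 s2 : `|step c s1 - step c s2| <= 2 * pi * L * `|s1 - s2|.
Proof.
rewrite /step opprD addrACA subrr addr0 -mulrBr normrM gtr0_norm//.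
have := norm_sinB (2 * pi * (c + s1)) (2 * pi * (c + s2)).
rewrite -mulrBr normrM gtr0_norm ?mulr_gt0//.
have -> : c + s1 - (c + s2) = s1 - s2 by ring.
have -> : 2 * pi * L * `|s1 - s2| = L * (2 * pi * `|s1 - s2|) by ring.
by rewrite ler_pM2l.
Qed.

Variables (sigma : R) (sL : 11 / 10 / M <= sigma).

Definition word_ball t n eta : set (nat -> R) :=
  [set t' | forall i, (i < n)%N -> `|t' i - t i| < eta].

(** Every word of the [eta]-ball around [t] has its letters in [[-sigma, sigma]]. *)
Definition admissible t n eta := 0 < eta /\ forall i, (i < n)%N -> `|t i| + eta <= sigma.

(** A single word serves both sets, and the centres [c0], [c1] are common to all noises near it,
    which makes the condition open. *)
Definition grown (A0 A1 : set R) r := exists n t eta c0 c1, admissible t n eta /\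
  forall t', word_ball t n eta t' -> expands t' n A0 c0 r /\ expands t' n A1 c1 r.

Lemma grown_le A0 A1 r r' : r' <= r -> grown A0 A1 r -> grown A0 A1 r'.
Proof.
move=> rr [n [t [eta [c0 [c1 [ad h]]]]]]; exists n, t, eta, c0, c1; split => // t' /h[e0 e1].
by split => y yr; [apply: e0|apply: e1]; exact: le_trans rr.
Qed.

Lemma extend_word t n eta c0 c1 : admissible t n eta ->
  exists s0, [/\ `|s0| <= 4^-1 / M * 2, forall k, 4^-1 / M <= `|c0 + s0 - crit k|,
    forall k, 4^-1 / M <= `|c1 + s0 - crit k| &
    forall eta', 0 < eta' -> eta' <= eta -> eta' <= 200^-1 / M ->
    let t2 := fun i => if i == n then s0 else t i in
    admissible t2 n.+1 eta' /\
    forall t', word_ball t2 n.+1 eta' t' -> word_ball t n eta t' /\ `|t' n - s0| <= eta' ].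
Proof.
move=> [eta0 tn].
have MV' := MV; have MV3' := MV3.
have [||s0 [s0D f0 f1]] := @exists_far_from_crit (4^-1 / M) c0 c1; [lra|lra|].
exists s0; split => //; first by lra.
move=> eta' eta'0 eta'le eta'M t2; split.
  split => // i; rewrite ltnS /t2 leq_eqVlt; case: eqVneq => [_ _|_ /= /tn].
    (* In units of [1 / M] the new letter needs [1/2 + 1/200], within the [11/10] granted by
       [sigma]. *)
    by have := sL; lra.
  by lra.
move=> t' ht'; split.
  move=> i ni; have := ht' i (ltnW ni); rewrite /t2 lt_eqF//.
  by move/lt_le_trans; exact.
by have := ht' n (ltnSn n); rewrite /t2 eqxx; exact: ltW.
Qed.

(** One step makes the arc at least [12] times longer. Changing the last letter by [eta'] moves the
    image centre by at most [2 pi L eta' <= r], so radius [2 * r] around the fixed centre remains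
    covered. *)
Lemma grown_step A0 A1 r : 0 < r -> r <= r1 -> grown A0 A1 r -> grown A0 A1 (2 * r).
Proof.
move=> r0 rd [n [t [eta [c0 [c1 [ad h]]]]]].
have [s0 [s0D f0 f1 ext]] := extend_word c0 c1 ad.
pose eta' := Num.min eta (Num.min (200^-1 / M) (r / (2 * pi * L))).
have c_gt0 : 0 < 2 * pi * L by rewrite !mulr_gt0.
have eta'0 : 0 < eta'.
  by rewrite !lt_min (divr_gt0 r0 c_gt0) andbT; case: ad => -> _ /=; have := MV; lra.
have [||ad' ball'] := ext eta' eta'0.
- by rewrite ge_min lexx.
- by rewrite !ge_min lexx orbT.
have eta'r : 2 * pi * L * eta' <= r.
  by rewrite mulrC -ler_pdivlMr// !ge_min lexx !orbT.
exists n.+1, (fun i => if i == n then s0 else t i), eta', (step c0 s0), (step c1 s0).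
split => // t' /ball'[/h[e0 e1] tn].
have tn' : `|t' n - s0| <= 200^-1 / M.
  by apply: le_trans tn _; rewrite !ge_min lexx orbT.
have l12 := lam_gt12; have l1 : 1 <= lam by lra.
have main c A : (forall k, 4^-1 / M <= `|c + s0 - crit k|) -> expands t' n A c r ->
    expands t' n.+1 A (step c s0) (2 * r).
  move=> fc ec y hy.
  have [u uc||x [Ax xy dx]] := @expands_step t' n A c r lam y r0 l1 _ ec.
  - by apply: (dstep_ge fc tn'); exact: le_trans rd.
  - have -> : y - step c (t' n) = (y - step c s0) - (step c (t' n) - step c s0) by ring.
    have h1 := ler_normB (y - step c s0) (step c (t' n) - step c s0).
    have h2 := step_lipschitz c (t' n) s0.
    have h3 : 2 * pi * L * `|t' n - s0| <= 2 * pi * L * eta' by rewrite ler_pM2l.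
    have h4 : 12 * r <= lam * r by rewrite ler_pM2r.
    by lra.
  - by exists x; split => //; exact: le_trans dx.
by split; apply: main.
Qed.

(** Repeated doubling, truncated at [r1] because beyond it the arc may reach a critical point. *)
Lemma grown_r1 A0 A1 r : 0 < r -> grown A0 A1 r -> grown A0 A1 r1.
Proof.
move=> r0 gr.
have g k : grown A0 A1 (Num.min (2 ^+ k * r) r1).
  elim: k => [|k IH]; first by apply: grown_le gr; rewrite expr0 mul1r ge_min lexx.
  have m0 : 0 < Num.min (2 ^+ k * r) r1 by rewrite lt_min mulr_gt0// exprn_gt0.
  have md : Num.min (2 ^+ k * r) r1 <= r1 by rewrite ge_min lexx orbT.
  apply: grown_le (grown_step m0 md IH).
  rewrite minr_pMr// mulrA -exprS le_min !ge_min lexx/=; apply/orP; right.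
  by rewrite ler_peMl// ?ltW// ltr1n.
have [k hk] : exists k : nat, r1 / r <= 2 ^+ k.
  exists (Num.truncn (r1 / r)).+1; apply: le_trans (ltW (truncnS_gt _)) _.
  by rewrite -natrX ler_nat ltnW// ltn_expl.
by apply: grown_le (g k); rewrite le_min lexx andbT -ler_pdivrMr.
Qed.

(** Once both arcs have half-length [r1], one more step away from the critical points gives
    half-length at least [13/25], more than half a turn. *)
Lemma exists_covering_word x0 x1 eps : 0 < eps ->
  exists n t eta, admissible t n.+1 eta /\
  forall t', word_ball t n.+1 eta t' ->
    covers t' n.+1 [set x | `|x - x0| <= eps] /\ covers t' n.+1 [set x | `|x - x1| <= eps].
Proof.
move=> eps0.
have sigma0 : 0 < sigma by apply: lt_le_trans sL; have := MV; lra.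
have g0 : grown [set x | `|x - x0| <= eps] [set x | `|x - x1| <= eps] eps.
  exists 0%N, (fun=> 0), sigma, x0, x1; split; first by split.
  by move=> t' _; split => y hy; exists y; split => //=; rewrite normr1.
have [n [t [eta [c0 [c1 [ad h]]]]]] := grown_r1 eps0 g0.
have [s0 [s0D f0 f1 ext]] := extend_word c0 c1 ad.
pose eta' := Num.min eta (200^-1 / M).
have eta'0 : 0 < eta' by rewrite lt_min; case: ad => -> _ /=; have := MV; lra.
have [||ad' ball'] := ext eta' eta'0.
- by rewrite ge_min lexx.
- by rewrite !ge_min lexx orbT.
exists n, (fun i => if i == n then s0 else t i), eta'; split => // t' /ball'[/h[e0 e1] tn].
have tn' : `|t' n - s0| <= 200^-1 / M.
  by apply: le_trans tn _; rewrite !ge_min lexx orbT.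
have l12 := lam_gt12; have l1 : 1 <= lam by lra.
have main c A : (forall k, 4^-1 / M <= `|c + s0 - crit k|) -> expands t' n A c r1 ->
    covers t' n.+1 A.
  move=> fc ec y.
  pose z := step c (t' n).
  (* With this integer [y + k] is within [1/2] of the centre [z], hence inside the image arc. *)
  pose k := Num.floor (z - y + 1 / 2).
  have [u uc||x [Ax xy dx]] := @expands_step t' n A c r1 lam (y + k%:~R) r1_gt0 l1 _ ec.
  - exact: (dstep_ge fc tn').
  - rewrite -/z; have := lam_r1_gt.
    have := @floor_le R (z - y + 1 / 2); have := floorD1_gt (z - y + 1 / 2).
    rewrite intrD -/k => k1 k2 hl.
    by rewrite ler_distl; apply/andP; split; lra.
  - exists x; split => //; first by rewrite xy addrAC subrr add0r intr_int.
    by apply: lt_le_trans dx; lra.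
by split; [exact: main f0 e0|exact: main f1 e1].
Qed.

End covering.

(** * Horseshoes *)

Section density.
Implicit Types (good : pred nat).

Definition hits good n : nat := \sum_(j < n) good j.

Lemma hitsS good n : hits good n.+1 = (hits good n + good n)%N.
Proof. by rewrite /hits big_ord_recr. Qed.

Lemma hits_const good m n : (m <= n)%N -> (forall j, (m <= j < n)%N -> ~~ good j) ->
  hits good n = hits good m.
Proof.
move=> /subnKC <-; elim: (n - m)%N => [|k IH] h; first by rewrite addn0.
rewrite addnS hitsS IH.
  by rewrite (negbTE (h _ _)) ?addn0// leq_addr/= addnS.
by move=> j /andP[mj jk]; apply: h; rewrite mj/= addnS (ltn_trans jk).
Qed.

Lemma enum_hits good : (forall m, exists2 n, (m <= n)%N & good n) ->
  exists g : nat -> nat, [/\ forall k, (g k < g k.+1)%N, forall k, good (g k) &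
    forall k, hits good (g k) = k].
Proof.
move=> inf.
have next m : {n | [/\ (m <= n)%N, good n & hits good n = hits good m]}.
  have ex : exists n, (m <= n)%N && good n by have [n mn gn] := inf m; exists n; apply/andP.
  case: (ex_minnP ex) => n /andP[mn gn] minn; exists n; split => //.
  apply: hits_const => // j /andP[mj jn]; apply/negP => gj.
  by have := minn j; rewrite mj gj => /(_ isT); rewrite leqNgt jn.
pose g := fix g k := if k is k'.+1 then sval (next (g k').+1) else sval (next 0%N).
have gg k : good (g k) by case: k => [|k] /=; [case: (next 0%N)|case: (next (g k).+1)] => n [].
exists g; split => // k; first by rewrite /=; case: (next (g k).+1) => n [].
elim: k => [|k IH] /=; first by case: (next 0%N) => n [_ _ ->]; rewrite /hits big_ord0.
by case: (next (g k).+1) => n [_ _ ->]; rewrite hitsS IH gg addn1.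
Qed.

End density.

Section positive_density.
Context {R : realType}.

Definition positive_lower_density (good : pred nat) :=
  exists2 c : R, 0 < c & exists n0, forall n, (n0 <= n)%N -> c * n%:R <= (hits good n)%:R.

(** Exactly [k] good times precede [g k], so the density bound at [g k] reads [c * g k <= k]; the
    times [g k < n0] are bounded by [n0]. *)
Lemma enum_positive_density (good : pred nat) (N : nat) : positive_lower_density good ->
  exists g : nat -> nat, [/\ forall k, (g k < g k.+1)%N, forall k, good (g k) &
    (limn_esup (fun k => ((N * g k)%:R / k%:R)%:E) < +oo :> \bar R)%E].
Proof.
move=> [c c0 [n0 hn]].
have hits_mono m n : (m <= n)%N -> (hits good m <= hits good n)%N.
  by move=> /subnKC <-; elim: (n - m)%N => [|k IH]; rewrite ?addn0// addnS hitsS (leq_trans IH)// leq_addr.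
have [m|g [g1 g2 g3]] := @enum_hits good.
  apply: contrapT => nex.
  have e n : (m <= n)%N -> hits good n = hits good m.
    move=> mn; apply: hits_const => // j /andP[mj _]; apply/negP => gj.
    by apply: nex; exists j.
  (* If the good times stopped at [m], the count would stay constant, while [c * n] exceeds it at
     this [n]. *)
  pose n := maxn (maxn n0 m) (Num.truncn ((hits good m)%:R / c)).+1.
  have := hn n; rewrite e; last by rewrite !leq_max leqnn orbT.
  rewrite !leq_max leqnn => /(_ isT); apply/negP; rewrite -ltNge mulrC -ltr_pdivrMr//.
  by apply: lt_le_trans (truncnS_gt _) _; rewrite ler_nat leq_max leqnn orbT.
exists g; split => //.
apply: (@le_lt_trans _ _ (N%:R * (n0%:R + c^-1))%:E); last exact: ltry.
rewrite limn_esup_lim; apply: lime_le; first exact: is_cvg_esups.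
(* The tail starts at [1], avoiding the division by zero at [k = 0]. *)
exists 1%N => // k /= k1; apply: ge_ereal_sup => _ /= [m km <-].
have m1 : (1 <= m)%N by exact: leq_trans km.
have m0 : 0 < m%:R :> R by rewrite ltr0n.
rewrite lee_fin natrM -mulrA ler_wpM2l// ler_pdivrMr// mulrDl.
have [h|h] := leqP n0 (g m).
  have := hn _ h; rewrite g3 -ler_pdivlMl// => h'.
  by apply: le_trans h' _; rewrite lerDr mulr_ge0.
apply: (@le_trans _ _ n0%:R); first by rewrite ler_nat ltnW.
apply: (@le_trans _ _ (n0%:R * m%:R)); first by rewrite ler_peMr// ler1n.
by rewrite lerDl mulr_ge0// invr_ge0 ltW.
Qed.

End positive_density.

(** * Positive frequency of visits to a cylinder *)

Section recurrence.
Context {R : realType} (s : {posnum R}).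
Variables (P : probability (noise_seq s) R) (PP : is_product_measure P).
Variables (N : nat) (A : nat -> set R) (mA : forall i, measurable (A i)).
Hypothesis PA : (0 < P (box N A))%E.

Let E : set (noise_seq s) := box N A.
Let mE : measurable E. Proof. exact: measurable_box. Qed.

Definition visits (w : noise_seq s) : pred nat := fun j => `[< E (iter (N * j) (@noise_shift R s) w) >].

(** Each visit costs a factor [1/2], so the product over the first [n] blocks is [2] to the power
    minus the number of visits; one block has mean [rho = 1 - P E / 2 < 1]. *)
Let weight (w : noise_seq s) : R := if `[< E w >] then 2^-1 else 1.

Let weightE w : weight w = 2^-1 * \1_E w + \1_(~` E) w.
Proof.
rewrite /weight !indicE; case: asboolP => Ew.
  by rewrite mem_set// memNset/= ?mulr1 ?addr0//; exact.
by rewrite memNset// mem_set// mulr0 add0r.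
Qed.

Let mweight : measurable_fun setT weight.
Proof.
rewrite (funext weightE).
apply: measurable_funD; last exact: measurable_indic (measurableC mE).
by apply: measurable_funM => //; exact: measurable_indic.
Qed.

Let rho : R := 1 - fine (P E) / 2.

Let integral_weight : (\int[P]_w (weight w)%:E = rho%:E)%E.
Proof.
under eq_integral do rewrite weightE EFinD EFinM.
have m1 : measurable_fun setT (fun w => (\1_E w)%:E : \bar R).
  by apply/measurable_EFinP; exact: measurable_indic.
have m2 : measurable_fun setT (fun w => (\1_(~` E) w)%:E : \bar R).
  by apply/measurable_EFinP; exact: measurable_indic (measurableC mE).
rewrite ge0_integralD//=; last exact: measurable_funeM.
rewrite ge0_integralZl_EFin//.
rewrite !integral_indic//; last exact: measurableC.
rewrite !setIT [X in (_ + X)%E](_ : _ = 1 - P E)%E; last exact: probability_setC.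
have PEf : P E = (fine (P E))%:E by rewrite fineK// fin_num_measure.
rewrite [X in (_ * X + _)%E](_ : _ = (fine (P E))%:E)// [X in (1 - X)%E](_ : _ = (fine (P E))%:E)//.
by rewrite -EFinM -EFinB -EFinD /rho; congr (_%:E); field.
Qed.

Let X n (w : noise_seq s) : R := 2^-1 ^+ hits (visits w) n.

Let XS n w : X n.+1 w = X n w * weight (iter (N * n) (@noise_shift R s) w).
Proof.
rewrite /X hitsS exprD /weight /visits; congr (_ * _).
by case: asboolP => _; rewrite ?expr1.
Qed.

Lemma visits_splice n w w' j : (j < n)%N -> visits (splice (N * n) w w') j = visits w j.
Proof.
move=> jn; rewrite /visits; congr asbool; rewrite /E /box /=; apply/propext.
have e i : (i < N)%N -> noise_coord i (iter (N * j) (@noise_shift R s) (splice (N * n) w w')) =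
    noise_coord i (iter (N * j) (@noise_shift R s) w).
  move=> iN; rewrite /noise_coord !iter_noise_shiftE /splice.
  have -> // : (N * j + i < N * n)%N.
  by apply: (@leq_trans (N * j.+1)); [rewrite mulnS addnC ltn_add2r|rewrite leq_mul2l jn orbT].
by split => h i iN; [rewrite -e//|rewrite e//]; exact: h.
Qed.

(** The blocks of length [N] are disjoint, hence independent, and the mean of [X n] is at most
    [rho ^+ n]. Almost surely [X n] is eventually at most [q ^+ n] with [rho < q < 1]; taking
    logarithms, the visits number at least [n (- ln q) / ln 2]. *)
Lemma ae_visits : {ae P, forall w, positive_lower_density (R := R) (visits w)}.
Proof.
have p0 : 0 < fine (P E).
  apply: fine_gt0; rewrite PA/=.
  exact: le_lt_trans (probability_le1 P mE) (ltry 1).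
have p1 : fine (P E) <= 1.
  by rewrite -lee_fin fineK ?fin_num_measure//; exact: probability_le1.
have rho0 : 0 < rho by rewrite /rho; lra.
pose q := (1 + rho) / 2.
have rq : rho < q by rewrite /q /rho; lra.
have mX n : measurable_fun setT (X n).
  elim: n => [|n IH].
    have -> : X 0%N = cst 1 by apply/funext => w; rewrite /X /hits big_ord0.
    exact: measurable_cst.
  rewrite (funext (XS n)).
  by apply: measurable_funM => //; exact: (measurableT_comp mweight (measurable_noise_shift _)).
have X0 n w : 0 <= X n w by rewrite /X exprn_ge0.
have IX n : (\int[P]_w (X n w)%:E <= (rho ^+ n)%:E)%E.
  apply: (@integral_prod_le _ _ _ PP N (fun n w => (X n w)%:E) (fun _ _ w' => (weight w')%:E)) => //.
  - by move=> w; rewrite /X /hits big_ord0.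
  - by move=> m; exact/measurable_EFinP.
  - by move=> m _; exact/measurable_EFinP.
  - by move=> m _ w; rewrite lee_fin /weight; case: ifP.
  - move=> m w w'; rewrite XS noise_shift_splice EFinM; congr (_%:E * _)%E.
    rewrite /X; congr (_ ^+ _); rewrite /hits; apply: eq_bigr => j _.
    by rewrite visits_splice.
  - by move=> m _; rewrite integral_weight.
have mXE n : measurable_fun setT (fun w => (X n w)%:E) by exact/measurable_EFinP.
have := @ae_eventually_le _ _ R P (fun n w => (X n w)%:E) rho q rho0 rq
   mXE (fun n w => X0 n w) IX.
apply: filterS => w [n0 hn0].
have q0 : 0 < q by exact: lt_trans rq.
have q1 : q < 1 by rewrite /q /rho; lra.
have l2 : 0 < ln 2 :> R by apply: ln_gt0; rewrite ltr1n.
exists (- ln q / ln 2); first by rewrite divr_gt0// oppr_gt0 ln_lt0// q0.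
exists n0 => n /hn0; rewrite lee_fin /X => h.
have : ln (2^-1 ^+ hits (visits w) n) <= ln (q ^+ n) by rewrite ler_ln// posrE exprn_gt0.
rewrite !lnXn ?invr_gt0// lnV ?posrE// => h'; rewrite -(mulr_natr (- ln 2)) -(mulr_natr (ln q)) in h'.
by rewrite mulrAC ler_pdivrMr//; lra.
Qed.

End recurrence.

(** * From visits to horseshoes *)

Section horseshoe.
Context {R : realType} (s : {posnum R}).
Variables (a L : R) (L9 : 9 <= L).

Lemma dclift_int t n x (k : int) :
  (exists l : int, clift L a t n (x + k%:~R) = clift L a t n x + l%:~R) /\
  dclift L a t n (x + k%:~R) = dclift L a t n x.
Proof.
elim: n => [|n [[l el] ed]] /=; first by split => //; exists k.
split; last by rewrite el ed dstep_int.
by exists 0; rewrite el addr0 addrAC sin_int.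
Qed.

Lemma cderiv_circle_iter_proj (w : noise_seq s) n x :
  cderiv (circle_iter L a w n) (circle_proj x) = dclift L a (fun i => noise_coord i w) n x.
Proof.
rewrite cderiv_circle_iter; have [k ->] := repr_circle_proj x.
by have [_] := dclift_int (fun i => noise_coord i w) n x k.
Qed.

Lemma circle_interval_ball (I : set (circle R)) : circle_interval I ->
  exists x0 eps, 0 < eps /\ forall x, `|x - x0| <= eps -> I (circle_proj x).
Proof.
move=> [_ [z Iz]].
have : nbhs (circle_proj (repr z)) I by rewrite circle_reprK; exact: Iz.
move=> /(@continuous_circle_proj R (repr z)) /nbhs_ballP[e /= e0 he].
exists (repr z), (e / 2); split; first by rewrite divr_gt0.
move=> x hx; apply: he; rewrite /ball/= distrC; apply: le_lt_trans hx _.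
by rewrite ltr_pdivrMr// ltr_pMr// ltr1n.
Qed.

(** The return times are the starts of the visited blocks. Two successive ones differ by at least
    [N], so the covering obtained along the first [N] letters persists until the next return. *)
Lemma horseshoe_of_visits (w : noise_seq s) (I : 'I_2 -> set (circle R)) N (A : nat -> set R)
    (x0 : 'I_2 -> R) (eps : R) :
  (0 < N)%N ->
  (forall i x, `|x - x0 i| <= eps -> I i (circle_proj x)) ->
  (forall w' : noise_seq s, box N A w' -> forall i,
     covers a L (fun i => noise_coord i w') N [set x | `|x - x0 i| <= eps]) ->
  positive_lower_density (R := R) (visits N A w) ->
  is_horseshoe L a w 2 I.
Proof.
move=> N0 hI hcov hd.
have [g [gS gv glim]] := enum_positive_density N hd.
pose n k := (N * g k)%N.
pose f k := circle_iter L a (iter (n k) (@noise_shift R s) w) (n k.+1 - n k).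
(* [J] is taken as large as possible; only surjectivity onto [I j] then needs an argument. *)
exists n, (fun k i j => [set z | [/\ I i z, I j (f k z) & 2 < `|cderiv (f k) z| ]]).
split => //; first by move=> k; rewrite ltn_pmul2l.
move=> k i j /=; rewrite -/(f k); split.
- by move=> z [].
- apply/seteqP; split => [_ [z [_ ? _] <-]//|y Iy].
  have /hcov/(_ i) cov : box N A (iter (n k) (@noise_shift R s) w).
    by have /asboolP := gv k.
  have Nle : (N <= n k.+1 - n k)%N.
    by rewrite /n -mulnBr leq_pmulr// subn_gt0.
  have [x [/= xx0 xy dx]] := covers_le L9 Nle cov (repr y).
  have fx : f k (circle_proj x) = y.
    by rewrite /f circle_iter_proj -[RHS]circle_reprK; exact/circle_projP.
  exists (circle_proj x) => //; split.
  + exact: hI.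
  + by rewrite fx.
  + by rewrite /f cderiv_circle_iter_proj.
- by move=> z [].
Qed.

Variables (P : probability (noise_seq s) R) (PP : is_product_measure P).

(** A code is a finite rational word with a radius [1 / (m + 1)]; codes form a countable type,
    enumerated by [unpickle]. *)
Definition code_box (c : seq rat * nat) (i : nat) : set R :=
  `](ratr (nth 0 c.1 i) - c.2.+1%:R^-1), (ratr (nth 0 c.1 i) + c.2.+1%:R^-1)[%classic.

Lemma measurable_code_box c i : measurable (code_box c i).
Proof. exact: measurable_itv. Qed.

Lemma code_box_gt0 c : (forall i, (i < size c.1)%N ->
    `|ratr (nth 0 c.1 i)| + c.2.+1%:R^-1 <= s%:num) ->
  (0 < P (box (size c.1) (code_box c)))%E.
Proof.
move=> h; rewrite /box (PP _ (measurable_code_box c)).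
elim/big_ind: _ => // [x y x0 y0|i _]; first exact: mule_gt0.
have := h i (ltn_ord i); set r : R := ratr _; set e : R := _^-1 => re.
have e0 : 0 < e by rewrite /e invr_gt0.
rewrite /noise_leb (_ : _ `&` _ = `]r - e, r + e[%classic).
  rewrite lebesgue_measure_itv/= lte_fin ltrBlDr -addrA ltrDl addr_gt0//.
  by rewrite -EFinB -EFinM lte_fin mulr_gt0 ?invr_gt0 ?mulr_gt0//; lra.
apply/seteqP; split => x; rewrite /code_box /= in_itv/= -/r -/e.
  by move=> [].
move=> xr; split => //; move: xr => /andP[x1 x2].
have r1 := ler_norm r; have r2 := ler_norm (- r); rewrite normrN in r2.
by apply/andP; split; lra.
Qed.

Lemma exists_horseshoes : 11 / 10 / Num.sqrt L <= s%:num ->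
  exists Omega' : set (noise_seq s),
      [/\ measurable Omega', P Omega' = 1%E &
      forall w, Omega' w ->
      forall I : 'I_2 -> set (circle R),
        circle_interval (I 0) -> circle_interval (I 1) -> is_horseshoe L a w 2 I].
Proof.
move=> sL.
(* The null set has to be fixed before the intervals are given, hence the intersection over all
   codes. *)
have : {ae P, forall w, forall n c, unpickle n = Some c ->
    (0 < P (box (size c.1) (code_box c)))%E ->
    positive_lower_density (R := R) (visits (size c.1) (code_box c) w)}.
  apply/ae_foralln => n; case: (unpickle n) => [c|]; last by apply: aeW.
  have [Pc|Pc] := pselect (0 < P (box (size c.1) (code_box c)))%E.
    by apply: filterS (ae_visits PP (measurable_code_box c) Pc) => w hw _ [<-].
  by apply: aeW => w _ [<-] /Pc.
move=> [Z [mZ PZ hZ]].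
exists (~` Z); split; first exact: measurableC.
  by have := probability_setC P mZ; rewrite PZ sube0.
move=> w Zw I I0 I1.
have {hZ Zw} good : forall n c, unpickle n = Some c ->
    (0 < P (box (size c.1) (code_box c)))%E ->
    positive_lower_density (R := R) (visits (size c.1) (code_box c) w).
  by apply: contrapT => /hZ.
have [x0 [e0 [e0_gt0 h0]]] := circle_interval_ball I0.
have [x1 [e1 [e1_gt0 h1]]] := circle_interval_ball I1.
pose eps := Num.min e0 e1.
have eps0 : 0 < eps by rewrite lt_min e0_gt0.
have [n [t [eta [[eta0 tn] hcov]]]] := exists_covering_word a L9 sL x0 x1 eps0.
(* Half of [eta] is for the rational approximation of the word and half for the radius, so the
   rational cylinder lies in the word ball. *)
have [m hm] : exists m : nat, (m.+1%:R^-1 : R) < eta / 2.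
  exists (Num.truncn (eta / 2)^-1); rewrite invf_plt ?posrE ?divr_gt0//.
  exact: truncnS_gt.
have mm : m.+1%:R^-1 + m.+1%:R^-1 < eta by rewrite [ltRHS]splitr ltrD.
have hr i : exists r : rat, `|ratr r - t i| < m.+1%:R^-1.
  have m0 : 0 < m.+1%:R^-1 :> R by rewrite invr_gt0.
  have [|r] := @rat_in_itvoo R (t i - m.+1%:R^-1) (t i + m.+1%:R^-1).
    by rewrite ltrBlDr -addrA ltrDl addr_gt0.
  by rewrite in_itv/= => rt; exists r; rewrite ltr_distl.
pose r i := sval (cid (hr i)).
have rP i : `|ratr (r i) - t i| < m.+1%:R^-1 by rewrite /r; case: cid.
pose c := (mkseq r n.+1, m).
have sc : size c.1 = n.+1 by rewrite size_mkseq.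
have nc i : (i < n.+1)%N -> nth 0 c.1 i = r i by move=> ni; rewrite nth_mkseq.
have := good (pickle c) c (pickleK c).
rewrite sc => hgood.
apply: (@horseshoe_of_visits w I n.+1 (code_box c) (fun i => if i == 0 then x0 else x1) eps) => //.
- move=> i x; case: eqVneq => [->|i0] hx.
    by apply: h0; apply: le_trans hx _; rewrite ge_min lexx.
  have -> : i = 1 by case: i i0 => -[|[|//]] //= ? ?; exact: val_inj.
  by apply: h1; apply: le_trans hx _; rewrite ge_min lexx orbT.
- move=> w' hw'.
  have [|c0 c1] := hcov (fun i => noise_coord i w').
    move=> i ni; have := hw' i ni; rewrite /code_box /= nth_mkseq// in_itv/= -ltr_distl => h.
    have -> : noise_coord i w' - t i = (noise_coord i w' - ratr (r i)) + (ratr (r i) - t i) by ring.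
    exact: le_lt_trans (ler_normD _ _) (lt_trans (ltrD h (rP i)) mm).
  by move=> i; case: eqVneq.
(* The rational cylinder stays inside [[-s, s]], since [|r i| + 1/(m+1) < |t i| + 2/(m+1) < |t i| +
   eta <= s]; hence its probability is positive. *)
- apply: hgood; rewrite -sc; apply: code_box_gt0 => i; rewrite sc => ni.
  have := tn i ni; rewrite /= nth_mkseq// => ht; have := rP i => hi.
  have : `|ratr (r i)| <= `|ratr (r i) - t i| + `|t i|.
    by rewrite -{1}(subrK (t i) (ratr (r i))) ler_normD.
  move: hi mm; move: (m.+1%:R^-1 : R) => e; lra.
Qed.

End horseshoe.

Theorem theorem1p2 (R : realType) :
  exists gamma kappa : R, [/\ 0 < gamma, 1 < kappa &
  forall (a L : R) (sigma : {posnum R}),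
    0 < a < 1 -> 9 <= L -> sigma%:num <= 1 / 2 ->
    11 / 10 * L `^ (- (1 / 2)) <= sigma%:num ->
  forall P : probability (noise_seq sigma) R, is_product_measure P ->
    {ae (P \x circle_leb)%E, forall wx : noise_seq sigma * circle R,
       ((gamma * ln L)%:E <
        limn_einf (fun n : nat =>
          (n%:R^-1)%:E * lne `|cderiv (circle_iter L a wx.1 n) wx.2|%:E))%E} /\
    exists Omega' : set (noise_seq sigma),
      [/\ measurable Omega', P Omega' = 1%E &
      forall w, Omega' w ->
      forall I : 'I_2 -> set (circle R),
        circle_interval (I 0) -> circle_interval (I 1) -> I 0 `&` I 1 = set0 ->
        is_horseshoe L a w kappa I]].
Proof.
exists (1 / 8), 2; split; [by []|by rewrite ltr1n|].
move=> a L sigma a01 L9 s12 sL P PP.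
split; first exact: lyapunov_exponent_gt.
have sL' : 11 / 10 / Num.sqrt L <= sigma%:num.
  have L0 : 0 <= L by lra.
  by move: sL; rewrite powRN mul1r powR12_sqrt.
have [Om [mO PO hO]] := exists_horseshoes a L9 PP sL'.
by exists Om; split => // w Ow I I0 I1 _; exact: hO.
Qed.
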